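(* For every integer $n\ge1$ and every $x\in\mathbb{R}$, $x\neq0$, $$G^{(1)}\!\left(\left.\begin{array}{c}1-n\\ 2\end{array}\right|x\right)=\frac1n\left\{\frac{1-e^{x}}{x}-\left[\ln|x|+\gamma-H_n-\mathrm{Ei}(x)\right]L_{n-1}^{(1)}(x)-\sum_{\ell=1}^{n-1}\left(\frac{n+\ell}{n-\ell}-e^{x}\,\mathrm{Re}\left[{}_2F_1\!\left(\left.\begin{array}{c}1,\ell\\ \ell+n\end{array}\right|2\right)\right]\right)\frac{L_{\ell-1}^{(1)}(x)}{\ell}\right\}.$$
   Context: $G^{(1)}\!\left(\left.\begin{array}{c}a\\ b\end{array}\right|x\right)=\frac{\partial}{\partial a}\left[{}_1F_1(a;b;x)\right]$ is the derivative of the Kummer confluent hypergeometric function with respect to its first parameter. Here $\gamma$ is Euler's constant, $H_n=\sum_{k=1}^n\frac1k$, $\mathrm{Ei}$ is the exponential integral (Cauchy principal value for $x>0$), so that $\mathrm{Ei}(x)=\gamma+\ln|x|+\sum_{k\ge1}\frac{x^k}{k\,k!}$ for real $x\ne0$, and $L_n^{(\alpha)}(x)=\sum_{m=0}^{n}\frac{\Gamma(n+\alpha+1)}{\Gamma(m+\alpha+1)}\frac{(-x)^m}{m!\,(n-m)!}$ are the Laguerre polynomials. The value ${}_2F_1(1,\ell;\ell+n;2)$ is that of the analytic continuation of the Gauss hypergeometric function to the branch cut $[1,\infty)$, i.e. the limit at $z=2$ from the upper or from the lower half-plane; its real part does not depend on the side. *)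

(* Defs.v *)
From Stdlib Require Export Reals Factorial.
From Coquelicot Require Export Coquelicot.

Open Scope R_scope.

Fixpoint pochhammer (a : R) (k : nat) : R :=
  match k with
  | O => 1
  | S j => pochhammer a j * (a + INR j)
  end.

(** The Kummer function [1F1(a;b;x)], for [b] not in [{0,-1,-2,...}]. *)
Definition hyp1F1 (a b x : R) : R :=
  Series (fun k => pochhammer a k / pochhammer b k * (x ^ k / INR (fact k))).

(** [Derive] is total; it is meaningful where [fun a => hyp1F1 a b x] is
    differentiable. *)
Definition G1 (a b x : R) : R := Derive (fun a' => hyp1F1 a' b x) a.

Definition harmonic (n : nat) : R := sum_n_m (fun k => / INR k) 1 n.

Definition euler_gamma : R :=
  real (Lim_seq (fun n => harmonic n - ln (INR n))).

(** [Ei x] is the integral of [exp t / t] over [(-oo, x]]; for [x > 0] it is the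
    Cauchy principal value at the pole [t = 0]. *)
Definition Ei (x : R) : R :=
  let f := fun t => exp t / t in
  if Rlt_dec x 0 then RInt_gen f (Rbar_locally m_infty) (at_point x)
  else iota (fun v : R =>
    filterlim
      (fun eps => RInt_gen f (Rbar_locally m_infty) (at_point (- eps))
                  + RInt f eps x)
      (at_right 0) (locally v)).

(** Euler's integral, for [s > 0]. *)
Definition Gamma (s : R) : R :=
  RInt_gen (fun t => Rpower t (s - 1) * exp (- t))
    (at_right 0) (Rbar_locally p_infty).

(** [L_n^(alpha)(x)], for [alpha > -1], so that [Gamma] is only used at positive
    arguments. *)
Definition laguerre (n : nat) (alpha x : R) : R :=
  sum_n (fun m =>
    Gamma (INR n + alpha + 1) / Gamma (INR m + alpha + 1)
    * ((- x) ^ m / (INR (fact m) * INR (fact (n - m))))) n.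

Definition hyp2F1_coef (a b c : R) (k : nat) : R :=
  pochhammer a k * pochhammer b k / (pochhammer c k * INR (fact k)).

Definition analytic_at (F : C -> C) (z0 : C) : Prop :=
  exists (u : nat -> C) (r : R), 0 < r /\
    forall z : C, Cmod (z - z0)%C < r ->
      is_pseries (K := C_AbsRing) (V := C_NormedModule) u (z - z0)%C (F z).

(** [F] is, off the cut [[1, +oo)], the principal branch of [2F1(a,b;c;.)]: the
    analytic function on the slit plane given by the Gauss series on the unit
    disc. The values of [F] on the cut are left unconstrained. *)
Definition is_hyp2F1 (a b c : R) (F : C -> C) : Prop :=
  (forall z : C, Cmod z < 1 ->
     is_pseries (K := C_AbsRing) (V := C_NormedModule)
       (fun k => RtoC (hyp2F1_coef a b c k)) z (F z)) /\
  (forall z : C, ~ (Im z = 0 /\ 1 <= Re z) -> analytic_at F z).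

Definition half_plane (upper : bool) (z : C) : Prop :=
  if upper then 0 < Im z else Im z < 0.

(** The value of [2F1(a,b;c;.)] at the point [x] of the cut, as the limit from
    the upper half-plane ([upper = true]) or from the lower one. *)
Definition hyp2F1_cut (upper : bool) (a b c x : R) : C :=
  iota (T := C_CompleteNormedModule) (fun v : C => exists F : C -> C, is_hyp2F1 a b c F /\
    filterlim F (within (half_plane upper) (locally (RtoC x))) (locally v)).

(* Main.v *)
(** Put [m = n - 1] and let [D = x d^2/dx^2 + (2 - x) d/dx + m] be the Kummer
    operator. Differentiating Kummer's equation in its parameter gives
    [D (n G) = L_m^(1)]. Since [Ei x = gamma + ln |x| + ein x] with [ein] entire,
    both sides of the identity are entire, and an entire solution of [D h = 0]
    with [h 0 = 0] vanishes because its coefficients satisfy a first order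
    recurrence. So it is enough to apply [D] to the right-hand side and to compare
    the values at [0].

    Write [c_l = Re 2F1(1, l; l + n; 2)]. Euler's integral
    [\int_0^1 t^(l-1) (1-t)^(n-1) / (1 - z t) dt] continues [2F1] to the slit
    plane; its contiguous relations reduce every limit at [z = 2] to that of
    [- ln (1 - z)], which is purely imaginary. They give
    [(n + l) (c_l - 1) = 2 l c_(l+1)] and [c_n = 0], so that the terms carrying
    [exp x] telescope, and, together with the relation shifting [n],
    [sum_(l < n) c_l = n H_n - n], which is the comparison at [0]. *)

Require Import Defs.
From Stdlib Require Import Reals Lra Lia.
From Coquelicot Require Import Coquelicot.

Open Scope R_scope.

(** Lets [ring] and [field] see an equation stated in one of Coquelicot's
    structures over [R]. *)
Ltac eqR := match goal with |- @eq _ ?a ?b => change (@eq R a b) end.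

(** The value [c_n = 0] reflects a symmetry: the real part at [2] is a principal value with kernel
    [1 / (1 - 2 t)], odd about [t = 1/2], while the weight is even when [l = n]. It removes the
    boundary terms of the telescoping sums. The factor [(n + l) / (n - l)] is dictated by [D]: the
    polynomial [L_(l-1)^(1)] solves Kummer's equation with [l - 1] in place of [n - 1], so [D]
    multiplies it by [n - l].

    Three analytic points need work. The parameter derivative rests on a second order Taylor bound
    for [pochhammer], explicit enough to be summed over the whole series. The constant in [Ei], an
    integral starting at minus infinity, is identified with [euler_gamma] by comparing [exp (- t)]
    with [(1 - t / N) ^ N] on [[0, N]]. The value on the cut is chosen by description, so any two
    continuations must agree off the real axis; expanding both along the segment from [0] reduces
    this to a supremum argument for real power series. *)

(** * The parameter derivative of the Kummer series *)

Lemma CV_radius_p_infty (a : nat -> R) :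
  (forall x, ex_pseries a x) -> CV_radius a = p_infty.
Proof.
  intros H.
  assert (Hge : forall x : R, Rbar_le (Rabs x) (CV_radius a)).
  { intros x. apply Rbar_not_lt_le. intros Hlt.
    apply (CV_disk_outside a x Hlt).
    apply (is_lim_seq_ext (fun k => scal (pow_n x k) (a k))).
    - intros k. rewrite pow_n_pow. apply Rmult_comm.
    - apply ex_series_lim_0, H. }
  destruct (CV_radius a) as [r| |]; [|reflexivity|].
  - specialize (Hge (Rabs r + 1)). simpl in Hge. exfalso.
    rewrite Rabs_pos_eq in Hge by (pose proof (Rabs_pos r); lra).
    pose proof (Rle_abs r); lra.
  - destruct (Hge 0).
Qed.

Lemma is_series_exp (x : R) : is_series (fun k => x ^ k / INR (fact k)) (exp x).
Proof.
  apply (is_series_ext (fun k => / INR (fact k) * x ^ k)).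
  - intros k. eqR. unfold Rdiv. ring.
  - apply is_pseries_R, is_exp_Reals.
Qed.

Lemma ex_series_exp_bound (u : nat -> R) (C M : R) :
  (forall k, Rabs (u k) <= C * (M ^ k / INR (fact k))) -> ex_series u.
Proof.
  intros H.
  apply (ex_series_le u (fun k => C * (M ^ k / INR (fact k)))).
  - exact H.
  - exists (scal C (exp M)). exact (is_series_scal C _ _ (is_series_exp M)).
Qed.

Lemma INR_fact_S (k : nat) : INR (fact (S k)) = (INR k + 1) * INR (fact k).
Proof. rewrite fact_simpl, mult_INR, S_INR. ring. Qed.

(** Each factor satisfies [|a + k| <= (k + 1) (1 + |a|)]. The factorial is later absorbed by one of
    the two factorials in the denominator of the Kummer coefficient. *)
Lemma Rabs_pochhammer_le (a : R) (k : nat) :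
  Rabs (pochhammer a k) <= INR (fact k) * (1 + Rabs a) ^ k.
Proof.
  pose proof (Rabs_pos a) as Ha.
  induction k as [|k IH]; simpl pochhammer.
  - rewrite Rabs_R1. simpl. lra.
  - rewrite Rabs_mult, INR_fact_S. simpl pow.
    assert (H : Rabs (a + INR k) <= (INR k + 1) * (1 + Rabs a)).
    { pose proof (pos_INR k). pose proof (Rabs_triang a (INR k)).
      rewrite (Rabs_pos_eq (INR k)) in H0 by assumption. nra. }
    replace ((INR k + 1) * INR (fact k) * ((1 + Rabs a) * (1 + Rabs a) ^ k))
      with (INR (fact k) * (1 + Rabs a) ^ k * ((INR k + 1) * (1 + Rabs a))) by ring.
    apply Rmult_le_compat; auto using Rabs_pos.
Qed.

(** The derivative of [pochhammer] in [a], in product rule form: the logarithmic form would divide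
    by [a + j], which vanishes for some [j] at the parameters [a = - m] of interest. *)
Fixpoint dpochhammer (a : R) (k : nat) : R :=
  match k with
  | O => 0
  | S j => dpochhammer a j * (a + INR j) + pochhammer a j
  end.

(** The base is one larger than for [pochhammer]: the extra [1] absorbs the undifferentiated term of
    the product rule. *)
Lemma Rabs_dpochhammer_le (a : R) (k : nat) :
  Rabs (dpochhammer a k) <= INR (fact k) * (2 + Rabs a) ^ k.
Proof.
  pose proof (Rabs_pos a) as Ha.
  induction k as [|k IH]; simpl dpochhammer.
  - rewrite Rabs_R0. simpl. lra.
  - pose proof (pos_INR k) as Hk. pose proof (INR_fact_lt_0 k) as Hf.
    eapply Rle_trans; [apply Rabs_triang|].
    rewrite Rabs_mult, INR_fact_S. simpl pow.
    assert (H : Rabs (a + INR k) <= (INR k + 1) * (1 + Rabs a)).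
    { pose proof (Rabs_triang a (INR k)) as H0.
      rewrite (Rabs_pos_eq (INR k)) in H0 by assumption. nra. }
    assert (H1 : Rabs (dpochhammer a k) * Rabs (a + INR k)
      <= INR (fact k) * (2 + Rabs a) ^ k * ((INR k + 1) * (1 + Rabs a)))
      by (apply Rmult_le_compat; auto using Rabs_pos).
    pose proof (Rabs_pochhammer_le a k) as H2.
    assert (H3 : (1 + Rabs a) ^ k <= (2 + Rabs a) ^ k) by (apply pow_incr; lra).
    assert (H4 : 0 <= (1 + Rabs a) ^ k) by (apply pow_le; lra).
    assert (H5 : INR (fact k) * (1 + Rabs a) ^ k
                 <= (INR k + 1) * (INR (fact k) * (2 + Rabs a) ^ k)).
    { assert (INR (fact k) * (1 + Rabs a) ^ k <= INR (fact k) * (2 + Rabs a) ^ k)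
        by (apply Rmult_le_compat_l; lra).
      assert (0 <= INR (fact k) * (2 + Rabs a) ^ k) by (apply Rmult_le_pos; lra).
      nra. }
    nra.
Qed.

(** The remainder obeys [Q_(k+1) = Q_k (a + h + k) + h^2 dpochhammer a k]. In the base [3 + |a|],
    the bound [|h| <= 1] takes one unit and the second summand another. *)
Lemma pochhammer_taylor (a h : R) (k : nat) :
  Rabs h <= 1 ->
  Rabs (pochhammer (a + h) k - pochhammer a k - h * dpochhammer a k)
    <= h ^ 2 * (INR (fact k) * (3 + Rabs a) ^ k).
Proof.
  intros Hh. pose proof (Rabs_pos a) as Ha.
  assert (Hh2 : 0 <= h ^ 2) by apply pow2_ge_0.
  induction k as [|k IH].
  - simpl. rewrite Rmult_0_r, !Rminus_0_r, Rminus_diag, Rabs_R0. nra.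
  - set (Q := pochhammer (a + h) k - pochhammer a k - h * dpochhammer a k) in *.
    simpl pochhammer; simpl dpochhammer.
    replace (_ - _ - _) with (Q * (a + h + INR k) + h ^ 2 * dpochhammer a k)
      by (unfold Q; ring).
    pose proof (pos_INR k) as Hk. pose proof (INR_fact_lt_0 k) as Hf.
    eapply Rle_trans; [apply Rabs_triang|].
    rewrite !Rabs_mult, (Rabs_pos_eq (h ^ 2)) by assumption.
    rewrite INR_fact_S. simpl pow at 3.
    assert (H : Rabs (a + h + INR k) <= (INR k + 1) * (2 + Rabs a)).
    { pose proof (Rabs_triang (a + h) (INR k)) as H0.
      pose proof (Rabs_triang a h) as H1.
      rewrite (Rabs_pos_eq (INR k)) in H0 by assumption. nra. }
    assert (H1 : Rabs Q * Rabs (a + h + INR k)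
      <= h ^ 2 * (INR (fact k) * (3 + Rabs a) ^ k) * ((INR k + 1) * (2 + Rabs a)))
      by (apply Rmult_le_compat; auto using Rabs_pos).
    pose proof (Rabs_dpochhammer_le a k) as H2.
    assert (H3 : (2 + Rabs a) ^ k <= (3 + Rabs a) ^ k) by (apply pow_incr; lra).
    assert (H4 : 0 <= (2 + Rabs a) ^ k) by (apply pow_le; lra).
    assert (H5 : Rabs (dpochhammer a k)
                 <= (INR k + 1) * (INR (fact k) * (3 + Rabs a) ^ k)).
    { assert (INR (fact k) * (2 + Rabs a) ^ k <= INR (fact k) * (3 + Rabs a) ^ k)
        by (apply Rmult_le_compat_l; lra).
      assert (0 <= INR (fact k) * (3 + Rabs a) ^ k) by (apply Rmult_le_pos; lra).
      nra. }
    apply (Rmult_le_compat_l (h ^ 2)) in H5; [|assumption].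
    simpl pow in H1, H5 |- *. nra.
Qed.

Lemma pochhammer_2 (k : nat) : pochhammer 2 k = INR (fact (S k)).
Proof.
  induction k as [|k IH]; [simpl; lra|].
  simpl pochhammer. rewrite IH, (INR_fact_S (S k)), S_INR. ring.
Qed.

Lemma is_derive_quadratic (f : R -> R) (a l C : R) :
  (forall h, Rabs h <= 1 -> Rabs (f (a + h) - f a - h * l) <= C * h ^ 2) ->
  is_derive f a l.
Proof.
  intros H. apply is_derive_Reals. intros eps Heps.
  (* The sign of [C] is not known; [Rabs C + 1] is a positive majorant. *)
  assert (HC : 0 < Rabs C + 1) by (pose proof (Rabs_pos C); lra).
  assert (Hd : 0 < Rmin 1 (eps / (Rabs C + 1)))
    by (apply Rmin_glb_lt; [lra|apply Rdiv_lt_0_compat; lra]).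
  exists (mkposreal _ Hd). intros h Hh0 Hh. simpl in Hh.
  assert (H1 : Rabs h <= 1) by (pose proof (Rmin_l 1 (eps / (Rabs C + 1))); lra).
  assert (H2 : Rabs h < eps / (Rabs C + 1))
    by (pose proof (Rmin_r 1 (eps / (Rabs C + 1))); lra).
  specialize (H h H1).
  replace ((f (a + h) - f a) / h - l) with ((f (a + h) - f a - h * l) / h)
    by (field; assumption).
  unfold Rdiv. rewrite Rabs_mult, Rabs_inv.
  pose proof (Rabs_pos_lt h Hh0) as Hp.
  apply (Rmult_lt_reg_r (Rabs h)); [assumption|].
  rewrite Rmult_assoc, Rinv_l, Rmult_1_r by lra.
  eapply Rle_lt_trans; [exact H|].
  rewrite <- (pow2_abs h).
  assert (H3 : Rabs h * (Rabs C + 1) < eps).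
  { apply (Rmult_lt_compat_r (Rabs C + 1)) in H2; [|assumption].
    unfold Rdiv in H2. rewrite Rmult_assoc, Rinv_l in H2 by lra. lra. }
  pose proof (Rle_abs C). nra.
Qed.

Definition dkummer_coef (a : R) (k : nat) : R :=
  dpochhammer a k / (INR (fact (S k)) * INR (fact k)).

Definition kummer_coef (a : R) (k : nat) : R :=
  pochhammer a k / (INR (fact (S k)) * INR (fact k)).

(** One factorial cancels the growth of [p], the other remains and yields an exponential series. The
    factor [q] is [1] for convergence and [h ^ 2] for the Taylor remainder. *)
Lemma fact_div_le (p q M x : R) (k : nat) :
  0 <= M -> 0 <= q -> Rabs p <= q * (INR (fact k) * M ^ k) ->
  Rabs (p / (INR (fact (S k)) * INR (fact k)) * x ^ k)
    <= q * ((M * Rabs x) ^ k / INR (fact k)).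
Proof.
  intros HM Hq Hp.
  pose proof (INR_fact_lt_0 k) as Hf. pose proof (INR_fact_lt_0 (S k)) as Hf'.
  rewrite Rabs_mult, <- RPow_abs, Rpow_mult_distr.
  unfold Rdiv. rewrite Rabs_mult, Rabs_inv, Rabs_mult.
  rewrite !Rabs_pos_eq with (x := INR _) by lra.
  replace (q * (M ^ k * Rabs x ^ k * / INR (fact k)))
    with (q * (INR (fact k) * M ^ k) * (/ (INR (fact k) * INR (fact k))
           * Rabs x ^ k)) by (field; lra).
  rewrite Rmult_assoc.
  assert (Hx : 0 <= Rabs x ^ k) by (apply pow_le, Rabs_pos).
  assert (Hi : / (INR (fact (S k)) * INR (fact k)) * Rabs x ^ k
    <= / (INR (fact k) * INR (fact k)) * Rabs x ^ k).
  { apply Rmult_le_compat_r; [assumption|].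
    apply Rinv_le_contravar; [nra|].
    assert (INR (fact k) <= INR (fact (S k))) by (apply le_INR, fact_le; lia). nra. }
  apply Rmult_le_compat; auto using Rabs_pos.
  apply Rmult_le_pos; [|assumption].
  left. apply Rinv_0_lt_compat, Rmult_lt_0_compat; assumption.
Qed.

Lemma ex_series_kummer (a x : R) : ex_series (fun k => kummer_coef a k * x ^ k).
Proof.
  apply (ex_series_exp_bound _ 1 ((1 + Rabs a) * Rabs x)). intros k.
  apply fact_div_le; [pose proof (Rabs_pos a); lra|lra|].
  rewrite Rmult_1_l. apply Rabs_pochhammer_le.
Qed.

Lemma ex_series_dkummer (a x : R) : ex_series (fun k => dkummer_coef a k * x ^ k).
Proof.
  apply (ex_series_exp_bound _ 1 ((2 + Rabs a) * Rabs x)). intros k.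
  apply fact_div_le; [pose proof (Rabs_pos a); lra|lra|].
  rewrite Rmult_1_l. apply Rabs_dpochhammer_le.
Qed.

Lemma hyp1F1_2 (a x : R) :
  hyp1F1 a 2 x = Series (fun k => kummer_coef a k * x ^ k).
Proof.
  apply Series_ext. intros k. unfold kummer_coef. rewrite pochhammer_2.
  field. split; apply INR_fact_neq_0.
Qed.

(** The termwise Taylor remainders add up to at most [h ^ 2 * exp M], a quadratic error, which gives
    differentiability at [a]. *)
Lemma is_derive_hyp1F1 (a x : R) :
  is_derive (fun a' => hyp1F1 a' 2 x) a (PSeries (dkummer_coef a) x).
Proof.
  set (M := (3 + Rabs a) * Rabs x).
  apply (is_derive_quadratic _ _ _ (exp M)). intros h Hh.
  rewrite !hyp1F1_2. unfold PSeries.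
  assert (S1 := ex_series_kummer a x). assert (S2 := ex_series_kummer (a + h) x).
  assert (S3 : ex_series (fun k => h * (dkummer_coef a k * x ^ k)))
    by exact (ex_series_scal_l h _ (ex_series_dkummer a x)).
  rewrite <- Series_scal_l, <- (Series_minus _ _ S2 S1).
  rewrite <- Series_minus by (first [exact S3 | exact (ex_series_minus _ _ S2 S1)]).
  assert (Hb : forall k,
    Rabs (kummer_coef (a + h) k * x ^ k - kummer_coef a k * x ^ k
          - h * (dkummer_coef a k * x ^ k)) <= h ^ 2 * (M ^ k / INR (fact k))).
  { intros k. unfold kummer_coef, dkummer_coef.
    replace (_ - _ - _) with
      ((pochhammer (a + h) k - pochhammer a k - h * dpochhammer a k)
         / (INR (fact (S k)) * INR (fact k)) * x ^ k)
      by (field; split; apply INR_fact_neq_0).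
    apply fact_div_le; [pose proof (Rabs_pos a); lra|apply pow2_ge_0|].
    apply pochhammer_taylor, Hh. }
  eapply Rle_trans; [apply Series_Rabs|].
  { apply (ex_series_exp_bound _ (h ^ 2) M). intros k. rewrite Rabs_Rabsolu. apply Hb. }
  eapply Rle_trans.
  - apply Series_le; [intros k; split; [apply Rabs_pos|apply Hb]|].
    exists (scal (h ^ 2) (exp M)). exact (is_series_scal (h ^ 2) _ _ (is_series_exp M)).
  - rewrite Series_scal_l, (is_series_unique _ _ (is_series_exp M)).
    apply Req_le; ring.
Qed.

(** * Gamma and Laguerre *)

Lemma is_RInt_gen_antiderivative {Fa Fb : (R -> Prop) -> Prop}
  {FFa : Filter Fa} {FFb : Filter Fb} (f g : R -> R) (la lb : R) :
  filter_prod Fa Fb (fun ab => forall x,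
    Rmin (fst ab) (snd ab) <= x <= Rmax (fst ab) (snd ab) ->
    is_derive f x (g x) /\ continuous g x) ->
  filterlim f Fa (locally la) -> filterlim f Fb (locally lb) ->
  is_RInt_gen g Fa Fb (lb - la).
Proof.
  intros Hd Ha Hb P HP.
  assert (Hlim : filterlim (fun ab : R * R => minus (f (snd ab)) (f (fst ab)))
                   (filter_prod Fa Fb) (locally (minus lb la))).
  { apply (filterlim_comp_2 (F := filter_prod Fa Fb) (G := locally lb)
      (H := locally (opp la)) (fun ab => f (snd ab)) (fun ab => opp (f (fst ab))) plus).
    - eapply filterlim_comp; [apply filterlim_snd|exact Hb].
    - eapply filterlim_comp; [eapply filterlim_comp; [apply filterlim_fst|exact Ha]|].
      apply (filterlim_opp (V := R_NormedModule)).
    - apply (filterlim_plus (V := R_NormedModule)). }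
  unfold filtermapi.
  specialize (Hlim P HP). unfold filtermap in Hlim.
  generalize (filter_and _ _ Hd Hlim). apply filter_imp.
  intros [a b] [H1 H2]. simpl in *.
  exists (minus (f b) (f a)). split; [|exact H2].
  apply (is_RInt_derive f g); intros x Hx; apply H1, Hx.
Qed.

(** An antiderivative of [t ^ k * exp (- t)] obtained by repeated integration by parts; it evaluates
    [Gamma] at the integers without a functional equation. *)
Fixpoint gamma_primitive (k : nat) (t : R) : R :=
  match k with
  | O => - exp (- t)
  | S j => - (t ^ k * exp (- t)) + INR k * gamma_primitive j t
  end.

Lemma is_derive_gamma_primitive (k : nat) (t : R) :
  is_derive (gamma_primitive k) t (t ^ k * exp (- t)).
Proof.
  induction k as [|k IH].
  - simpl. auto_derive; [trivial|ring].
  - assert (H : is_derive (fun t => - (t ^ S k * exp (- t))) t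
      (- (INR (S k) * t ^ k * exp (- t) - t ^ S k * exp (- t)))).
    { auto_derive; [trivial|]. rewrite S_INR. destruct k; simpl; ring. }
    generalize (is_derive_plus _ _ t _ _ H (is_derive_scal _ t (INR (S k)) _ IH)).
    intros H'. eapply is_derive_ext; [|replace (t ^ S k * exp (- t)) with
      (plus (- (INR (S k) * t ^ k * exp (- t) - t ^ S k * exp (- t)))
         (INR (S k) * (t ^ k * exp (- t)))); [exact H'|]].
    + reflexivity.
    + unfold plus; simpl plus. cbn -[INR pow]. ring.
Qed.

Lemma gamma_primitive_0 (k : nat) : gamma_primitive k 0 = - INR (fact k).
Proof.
  induction k as [|k IH].
  - simpl. rewrite Ropp_0, exp_0. reflexivity.
  - cbn [gamma_primitive]. rewrite IH, INR_fact_S, S_INR, pow_i by lia. ring.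
Qed.

Lemma exp_ge_monomial (k : nat) (t : R) : 0 <= t -> t ^ k / INR (fact k) <= exp t.
Proof.
  intros Ht. eapply Rle_trans; [|apply (exp_ge_taylor t k Ht)].
  destruct k as [|k]; [simpl; lra|].
  rewrite tech5.
  assert (0 <= sum_f_R0 (fun j => t ^ j / INR (fact j)) k).
  { apply cond_pos_sum. intros j. apply Rdiv_le_0_compat; [apply pow_le, Ht|apply INR_fact_lt_0]. }
  lra.
Qed.

(** The monomial bound on [exp] is taken at degree [k + 1]: the spare power gives decay like
    [1 / t]. *)
Lemma is_lim_pow_exp_neg (k : nat) : is_lim (fun t => t ^ k * exp (- t)) p_infty 0.
Proof.
  apply (is_lim_le_le_loc (fun _ => 0) (fun t => INR (fact (S k)) * / t)).
  - exists 0. intros t Ht.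
    assert (Hk : 0 <= t ^ k) by (apply pow_le; lra).
    pose proof (exp_pos (- t)) as He.
    split; [apply Rmult_le_pos; lra|].
    pose proof (exp_ge_monomial (S k) t ltac:(lra)) as H.
    pose proof (INR_fact_lt_0 (S k)) as Hf.
    rewrite exp_Ropp.
    apply (Rmult_le_reg_r t); [assumption|].
    rewrite Rmult_assoc, (Rmult_assoc _ (/ t)), Rinv_l, Rmult_1_r by lra.
    pose proof (exp_pos t) as He'.
    apply (Rmult_le_reg_r (exp t)); [assumption|].
    replace (t ^ k * (/ exp t * t) * exp t) with (t ^ S k) by (simpl; field; lra).
    apply (Rmult_le_compat_l (INR (fact (S k)))) in H; [|lra].
    replace (INR (fact (S k)) * (t ^ S k / INR (fact (S k)))) with (t ^ S k) in H
      by (field; lra).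
    exact H.
  - apply is_lim_const.
  - replace (Finite 0) with (Rbar_mult (INR (fact (S k))) 0) by (simpl; f_equal; ring).
    apply is_lim_scal_l. apply (is_lim_inv (fun t => t) p_infty p_infty);
      [apply is_lim_id|discriminate].
Qed.

Lemma is_lim_gamma_primitive (k : nat) : is_lim (gamma_primitive k) p_infty 0.
Proof.
  induction k as [|k IH].
  - apply (is_lim_ext (fun t => - (t ^ 0 * exp (- t)))); [intros t; simpl; ring|].
    replace (Finite 0) with (Rbar_opp 0) by (simpl; f_equal; ring).
    apply is_lim_opp, is_lim_pow_exp_neg.
  - replace (Finite 0) with (Finite (- 0 + INR (S k) * 0)) by (f_equal; ring).
    apply (is_lim_plus' (fun t => - (t ^ S k * exp (- t)))
             (fun t => INR (S k) * gamma_primitive k t)).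
    + apply (is_lim_opp _ _ 0), is_lim_pow_exp_neg.
    + apply (is_lim_scal_l _ (INR (S k)) _ 0), IH.
Qed.

Lemma Gamma_INR (k : nat) : Gamma (INR k + 1) = INR (fact k).
Proof.
  unfold Gamma. apply is_RInt_gen_unique.
  apply (is_RInt_gen_ext (fun t => t ^ k * exp (- t))).
  (* [Rpower] is identified with the integer power at positive [t] only; both endpoint filters allow
     a restriction to positive endpoints. *)
  { exists (fun a => 0 < a) (fun b => 0 < b).
    - exists (mkposreal 1 Rlt_0_1). intros y _ Hy. exact Hy.
    - exists 0. auto.
    - intros a b Ha Hb t [Ht _]. simpl in Ht.
      assert (0 < t) by (eapply Rlt_trans; [|exact Ht]; apply Rmin_glb_lt; assumption).
      replace (INR k + 1 - 1) with (INR k) by ring.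
      rewrite Rpower_pow by assumption. reflexivity. }
  replace (INR (fact k)) with (0 - gamma_primitive k 0)
    by (rewrite gamma_primitive_0; ring).
  apply (is_RInt_gen_antiderivative (gamma_primitive k)).
  - exists (fun _ => True) (fun _ => True); try (apply filter_true).
    intros a b _ _ t _. split; [apply is_derive_gamma_primitive|].
    apply (ex_derive_continuous (fun t => t ^ k * exp (- t))). auto_derive. trivial.
  - eapply filterlim_filter_le_1; [apply filter_le_within|].
    apply (ex_derive_continuous (gamma_primitive k)).
    eexists. apply is_derive_gamma_primitive.
  - apply (is_lim_gamma_primitive k).
Qed.

Lemma pochhammer_neg_INR (m k : nat) :
  (k <= m)%nat ->
  pochhammer (- INR m) k = (-1) ^ k * INR (fact m) / INR (fact (m - k)).
Proof.
  induction k as [|k IH]; intros Hk.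
  - simpl. rewrite Nat.sub_0_r. field. apply INR_fact_neq_0.
  - cbn [pochhammer pow]. rewrite IH by lia.
    replace (m - k)%nat with (S (m - S k)) by lia.
    rewrite INR_fact_S, minus_INR by lia. rewrite S_INR.
    assert (INR k + 1 <= INR m) by (rewrite <- S_INR; apply le_INR; lia).
    field. split; [apply INR_fact_neq_0|lra].
Qed.

Lemma pochhammer_neg_INR_0 (m k : nat) :
  (m < k)%nat -> pochhammer (- INR m) k = 0.
Proof.
  intros H. induction H as [|k Hk IH]; cbn [pochhammer].
  - ring.
  - rewrite IH. ring.
Qed.

Lemma pochhammer_S_l (a : R) (k : nat) :
  pochhammer a (S k) = a * pochhammer (a + 1) k.
Proof.
  induction k as [|k IH]; [simpl; ring|].
  change (pochhammer a (S (S k))) with (pochhammer a (S k) * (a + INR (S k))).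
  rewrite IH, S_INR. cbn [pochhammer]. ring.
Qed.

Lemma is_pseries_kummer (a x : R) :
  is_pseries (kummer_coef a) x (PSeries (kummer_coef a) x).
Proof.
  apply is_pseries_R, Series_correct, ex_series_kummer.
Qed.

Lemma is_pseries_dkummer (a x : R) :
  is_pseries (dkummer_coef a) x (PSeries (dkummer_coef a) x).
Proof.
  apply is_pseries_R, Series_correct, ex_series_dkummer.
Qed.

(** The Laguerre polynomial [L_m^(1)] and its derivative, as Kummer series. *)
Definition lag (m : nat) (x : R) : R :=
  INR (S m) * PSeries (kummer_coef (- INR m)) x.

Definition dlag (m : nat) (x : R) : R :=
  INR (S m) * PSeries (PS_derive (kummer_coef (- INR m))) x.

(** [pochhammer (- INR m) k] vanishes for [k > m], so the Kummer series terminates at [m]; up to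
    there the Gamma quotients are quotients of factorials. *)
Lemma laguerre_lag (m : nat) (x : R) : laguerre m 1 x = lag m x.
Proof.
  unfold lag. symmetry.
  transitivity (Series (fun k => INR (S m) * (kummer_coef (- INR m) k * x ^ k))).
  { unfold PSeries. rewrite Series_scal_l. reflexivity. }
  apply is_series_unique. unfold laguerre.
  match goal with |- is_series ?u _ =>
    apply (is_series_ext (fun k => if (k <=? m)%nat then u k else 0)) end.
  { intros k. destruct (Nat.leb_spec k m) as [H|H]; [reflexivity|].
    unfold kummer_coef. rewrite pochhammer_neg_INR_0 by assumption.
    eqR. unfold Rdiv. ring. }
  apply (filterlim_ext_loc (fun _ => sum_n (fun k : nat =>
     Gamma (INR m + 1 + 1) / Gamma (INR k + 1 + 1) *
     ((- x) ^ k / (INR (fact k) * INR (fact (m - k))))) m));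
    [|apply filterlim_const].
  exists m. intros N HN.
  induction HN as [|N HN IH].
  - apply sum_n_ext_loc. intros k Hk. rewrite (proj2 (Nat.leb_le k m) Hk).
    rewrite <- (S_INR m), <- (S_INR k), !Gamma_INR. unfold kummer_coef.
    rewrite pochhammer_neg_INR by assumption.
    replace (- x) with (-1 * x) by ring. rewrite Rpow_mult_distr, (INR_fact_S m), S_INR.
    eqR. field. repeat split; apply INR_fact_neq_0.
  - rewrite sum_Sn, <- IH.
    replace (S N <=? m)%nat with false by (symmetry; apply Nat.leb_gt; lia).
    symmetry. apply (plus_zero_r (G := R_AbelianMonoid)).
Qed.

Lemma is_pseries_lincomb2 (a b : nat -> R) (p q x la lb : R) :
  is_pseries a x la -> is_pseries b x lb ->
  is_pseries (fun k => p * a k + q * b k) x (p * la + q * lb).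
Proof.
  intros Ha Hb.
  exact (is_pseries_plus _ _ _ _ _
    (is_pseries_scal p _ x _ (Rmult_comm _ _) Ha)
    (is_pseries_scal q _ x _ (Rmult_comm _ _) Hb)).
Qed.

Lemma is_pseries_derive_PSeries (a : nat -> R) (x : R) :
  (forall y, ex_pseries a y) ->
  is_derive (PSeries a) x (PSeries (PS_derive a) x) /\
  is_pseries (PS_derive a) x (PSeries (PS_derive a) x).
Proof.
  intros H. pose proof (CV_radius_p_infty a H) as Hr.
  assert (Hx : Rbar_lt (Rabs x) (CV_radius a)) by (rewrite Hr; exact I).
  split; [apply is_derive_PSeries, Hx|apply PSeries_correct, ex_pseries_derive, Hx].
Qed.

Lemma is_derive_lag (m : nat) (x : R) : is_derive (lag m) x (dlag m x).
Proof.
  apply is_derive_scal, is_pseries_derive_PSeries.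
  intros y. eexists. apply is_pseries_kummer.
Qed.

Lemma is_pseries_dlag_aux (a x : R) :
  is_pseries (PS_derive (kummer_coef a)) x (PSeries (PS_derive (kummer_coef a)) x).
Proof.
  apply is_pseries_derive_PSeries. intros y. eexists. apply is_pseries_kummer.
Qed.

Lemma lag_0 (m : nat) : lag m 0 = INR (S m).
Proof.
  unfold lag. rewrite PSeries_0. unfold kummer_coef. simpl pochhammer. simpl fact.
  simpl INR. field.
Qed.

Lemma kummer_coef_S (a : R) (k : nat) :
  INR (S k) * kummer_coef a (S k)
    = a * pochhammer (a + 1) k / (INR (fact (S (S k))) * INR (fact k)).
Proof.
  unfold kummer_coef. rewrite pochhammer_S_l, (INR_fact_S k), <- S_INR.
  field. repeat split; try apply INR_fact_neq_0. apply not_0_INR; lia.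
Qed.

(** Coefficientwise, all three terms are rational multiples of [pochhammer (- INR m) k]: the first
    factor is split off on the left, the last one on the right. *)
Lemma dlag_S (m : nat) (x : R) : dlag (S m) x = dlag m x - lag m x.
Proof.
  unfold dlag, lag.
  transitivity (PSeries (fun k => INR (S (S m)) * PS_derive (kummer_coef (- INR (S m))) k) x).
  { symmetry. apply (PSeries_scal (INR (S (S m)))). }
  rewrite <- Rmult_minus_distr_l.
  apply is_pseries_unique.
  replace (INR (S m) * _) with
    (INR (S m) * PSeries (PS_derive (kummer_coef (- INR m))) x
     + (- INR (S m)) * PSeries (kummer_coef (- INR m)) x) by ring.
  eapply is_pseries_ext;
    [|apply is_pseries_lincomb2; [apply is_pseries_dlag_aux|apply is_pseries_kummer]].
  intros k. cbv beta. unfold PS_derive. rewrite !kummer_coef_S. unfold kummer_coef.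
  replace (- INR (S m) + 1) with (- INR m) by (rewrite S_INR; ring).
  rewrite <- (pochhammer_S_l (- INR m)). cbn [pochhammer].
  rewrite !INR_fact_S, !S_INR. pose proof (pos_INR k).
  eqR. field. repeat split; try apply INR_fact_neq_0; lra.
Qed.

(** Together with [dlag_S] it yields the three term relation and drives the telescoping Laguerre
    sums. *)
Lemma dlag_S_lag (m : nat) (x : R) :
  x * dlag (S m) x = INR (S m) * lag (S m) x - INR (S (S m)) * lag m x.
Proof.
  unfold dlag, lag.
  transitivity (PSeries (fun k => INR (S (S m)) * PS_incr_1 (PS_derive (kummer_coef (- INR (S m)))) k) x).
  { symmetry. etransitivity; [apply (PSeries_scal (INR (S (S m))))|].
    rewrite PSeries_incr_1. ring. }
  apply is_pseries_unique.
  replace (INR (S m) * _ - _) with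
    ((INR (S m) * INR (S (S m))) * PSeries (kummer_coef (- INR (S m))) x
     + (- (INR (S m) * INR (S (S m)))) * PSeries (kummer_coef (- INR m)) x) by ring.
  eapply is_pseries_ext;
    [|apply is_pseries_lincomb2; apply is_pseries_kummer].
  intros [|k]; cbv beta.
  - unfold kummer_coef, PS_incr_1. simpl pochhammer.
    transitivity 0; [eqR; ring|symmetry; apply Rmult_0_r].
  - unfold PS_incr_1, PS_derive.
    rewrite kummer_coef_S.
    replace (- INR (S m) + 1) with (- INR m) by (rewrite S_INR; ring).
    unfold kummer_coef. rewrite (pochhammer_S_l (- INR (S m))).
    replace (- INR (S m) + 1) with (- INR m) by (rewrite S_INR; ring).
    cbn [pochhammer]. rewrite !INR_fact_S, !S_INR. pose proof (pos_INR k).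
    eqR. field. repeat split; try apply INR_fact_neq_0; lra.
Qed.

(** * The exponential integral *)

(** [ein x = sum_(k >= 1) x^k / (k k!)], whose derivative is
    [expm1_div x = (exp x - 1) / x]. *)
Definition ein_coef (k : nat) : R :=
  match k with O => 0 | S _ => / (INR k * INR (fact k)) end.

Definition ein (x : R) : R := PSeries ein_coef x.

Definition expm1_div_coef (k : nat) : R := / INR (fact (S k)).

Definition expm1_div (x : R) : R := PSeries expm1_div_coef x.

Lemma is_pseries_expm1_div (x : R) : is_pseries expm1_div_coef x (expm1_div x).
Proof.
  apply is_pseries_R, Series_correct.
  apply (ex_series_exp_bound _ 1 (Rabs x)). intros k. unfold expm1_div_coef.
  rewrite Rabs_mult, <- RPow_abs, Rabs_inv, Rabs_pos_eq by apply pos_INR.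
  pose proof (INR_fact_lt_0 k) as H.
  assert (INR (fact k) <= INR (fact (S k))) by (apply le_INR, fact_le; lia).
  assert (/ INR (fact (S k)) <= / INR (fact k)) by (apply Rinv_le_contravar; lra).
  pose proof (pow_le (Rabs x) k (Rabs_pos x)). unfold Rdiv. nra.
Qed.

Lemma expm1_div_spec (x : R) : x * expm1_div x = exp x - 1.
Proof.
  assert (H1 := is_exp_Reals x).
  rewrite <- (is_pseries_unique _ _ _ H1).
  rewrite (PSeries_decr_1 _ x (ex_intro _ _ H1)). change (INR (fact 0)) with 1.
  rewrite Rinv_1. unfold expm1_div.
  change (PS_decr_1 (fun k => / INR (fact k))) with expm1_div_coef.
  ring.
Qed.

Lemma expm1_div_eq (x : R) : x <> 0 -> expm1_div x = (exp x - 1) / x.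
Proof.
  intros H. rewrite <- expm1_div_spec. field. exact H.
Qed.

Lemma ex_pseries_ein (x : R) : ex_pseries ein_coef x.
Proof.
  apply ex_pseries_R.
  apply (ex_series_exp_bound _ 1 (Rabs x)). intros k.
  rewrite Rabs_mult, <- RPow_abs. rewrite Rmult_1_l, Rmult_comm. unfold Rdiv.
  apply Rmult_le_compat_l; [apply pow_le, Rabs_pos|].
  destruct k as [|k].
  - simpl. rewrite Rabs_R0, Rinv_1. lra.
  - unfold ein_coef. pose proof (INR_fact_lt_0 (S k)) as H.
    assert (H1 : 1 <= INR (S k)) by (rewrite S_INR; pose proof (pos_INR k); lra).
    rewrite Rabs_inv, Rabs_pos_eq by nra.
    apply Rinv_le_contravar; nra.
Qed.

Lemma is_derive_ein (x : R) : is_derive ein x (expm1_div x).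
Proof.
  destruct (is_pseries_derive_PSeries ein_coef x ex_pseries_ein) as [H _].
  replace (expm1_div x) with (PSeries (PS_derive ein_coef) x); [exact H|].
  apply PSeries_ext. intros k. unfold PS_derive, ein_coef, expm1_div_coef.
  field. split; [apply INR_fact_neq_0|apply not_0_INR; lia].
Qed.

Lemma is_derive_ein_neg (t : R) :
  is_derive (fun s => - ein (- s)) t (expm1_div (- t)).
Proof.
  replace (expm1_div (- t)) with (opp (scal (-1) (expm1_div (- t))))
    by (unfold opp, scal; cbn; unfold mult; cbn; ring).
  apply (is_derive_opp (fun s => ein (- s))).
  apply (is_derive_comp ein (fun s => - s)); [apply is_derive_ein|].
  auto_derive; [trivial|ring].
Qed.

Lemma ein_0 : ein 0 = 0.
Proof. apply (PSeries_0 ein_coef). Qed.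

(** * Euler's constant from harmonic numbers *)

Lemma is_derive_nondecreasing (f df : R -> R) (a b : R) :
  a <= b -> (forall t, a <= t <= b -> is_derive f t (df t)) ->
  (forall t, a < t < b -> 0 <= df t) -> f a <= f b.
Proof.
  intros [Hab| ->] Hd Hp; [|lra].
  destruct (MVT_cor2 f df a b Hab) as [c [E Hc]].
  { intros c Hc. apply is_derive_Reals, Hd, Hc. }
  specialize (Hp c Hc). nra.
Qed.

Lemma bernoulli_ineq (u : R) (N : nat) : 0 <= u <= 1 -> 1 - INR N * u <= (1 - u) ^ N.
Proof.
  intros Hu. induction N as [|N IH]; [simpl; lra|].
  rewrite S_INR. simpl pow. pose proof (pos_INR N).
  assert ((1 - u) * (1 - INR N * u) <= (1 - u) * (1 - u) ^ N)
    by (apply Rmult_le_compat_l; lra).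
  assert (0 <= INR N * u * u) by (apply Rmult_le_pos; [apply Rmult_le_pos|]; lra).
  lra.
Qed.

Lemma exp_pow (u : R) (N : nat) : exp u ^ N = exp (INR N * u).
Proof.
  induction N as [|N IH].
  - simpl. rewrite Rmult_0_l, exp_0. reflexivity.
  - rewrite S_INR, Rmult_plus_distr_r, exp_plus, <- IH, Rmult_1_l. simpl. ring.
Qed.

(** With [u = t / N], the lower bound is [1 - u <= exp (- u)] raised to the power [N]. For the upper
    one, [(1 - u)^N exp t] dominates [(1 - u^2)^N], hence [1 - N u^2] by Bernoulli; then multiply by
    [exp (- t)]. *)
Lemma exp_neg_sub_pow (N : nat) (t : R) :
  (1 <= N)%nat -> 0 <= t <= INR N ->
  0 <= exp (- t) - (1 - t / INR N) ^ N <= t ^ 2 * exp (- t) / INR N.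
Proof.
  intros HN Ht. assert (HN' : 1 <= INR N) by (apply (le_INR 1); assumption).
  set (u := t / INR N).
  assert (Hu : 0 <= u <= 1).
  { unfold u. split; [apply Rdiv_le_0_compat; lra|].
    apply (Rmult_le_reg_r (INR N)); [lra|]. unfold Rdiv.
    rewrite Rmult_assoc, Rinv_l by lra. lra. }
  assert (Et : t = INR N * u) by (unfold u; field; lra).
  pose proof (exp_pos (- t)) as He.
  split.
  - assert ((1 - u) ^ N <= exp (- t)); [|lra].
    rewrite Et, Ropp_mult_distr_r, <- exp_pow. apply pow_incr.
    pose proof (exp_ineq1_le (- u)). lra.
  - assert (H1 : (1 + u) ^ N <= exp t).
    { rewrite Et, <- exp_pow. apply pow_incr. pose proof (exp_ineq1_le u). lra. }
    assert (H2 : 1 - INR N * u ^ 2 <= (1 - u) ^ N * (1 + u) ^ N).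
    { rewrite <- Rpow_mult_distr. replace ((1 - u) * (1 + u)) with (1 - u ^ 2) by ring.
      apply bernoulli_ineq. nra. }
    assert (H3 : 0 <= (1 - u) ^ N) by (apply pow_le; lra).
    assert (H4 : 1 - INR N * u ^ 2 <= (1 - u) ^ N * exp t) by nra.
    apply (Rmult_le_compat_r (exp (- t))) in H4; [|lra].
    rewrite Rmult_assoc, <- exp_plus, Rplus_opp_r, exp_0 in H4.
    replace (t ^ 2 * exp (- t) / INR N) with (INR N * u ^ 2 * exp (- t))
      by (unfold u; field; lra).
    lra.
Qed.

(** With [c = 1 / N] and [n = N] this is
    [\int_0^t (1 - (1 - s / N) ^ N) / s ds - H_N]. *)
Fixpoint pow_sum (c : R) (n : nat) (t : R) : R :=
  match n with
  | O => 0
  | S j => pow_sum c j t - (1 - c * t) ^ n / INR n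
  end.

Fixpoint dpow_sum (c : R) (n : nat) (t : R) : R :=
  match n with
  | O => 0
  | S j => dpow_sum c j t + c * (1 - c * t) ^ j
  end.

Lemma is_derive_pow_sum (c : R) (n : nat) (t : R) :
  is_derive (pow_sum c n) t (dpow_sum c n t).
Proof.
  induction n as [|n IH].
  - apply (is_derive_const 0).
  - assert (H : is_derive (fun t => (1 - c * t) ^ S n / INR (S n)) t (- (c * (1 - c * t) ^ n))).
    { auto_derive; [trivial|]. 
      change (match n with 0%nat => 1 | S _ => INR n + 1 end) with (INR (S n)).
      unfold Rminus. field. apply not_0_INR; lia. }
    generalize (is_derive_minus _ _ _ _ _ IH H).
    unfold minus, plus, opp; simpl AbelianGroup.opp. cbn -[INR pow].
    intros H'. replace (dpow_sum c n t + c * (1 - c * t) ^ n)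
      with (dpow_sum c n t + - - (c * (1 - c * t) ^ n)) by ring.
    exact H'.
Qed.

Lemma dpow_sum_spec (c : R) (n : nat) (t : R) :
  t * dpow_sum c n t = 1 - (1 - c * t) ^ n.
Proof.
  induction n as [|n IH]; simpl; [ring|].
  rewrite Rmult_plus_distr_l, IH. ring.
Qed.

Lemma harmonic_S (n : nat) : harmonic (S n) = harmonic n + / INR (S n).
Proof.
  unfold harmonic. rewrite sum_n_Sm by lia. reflexivity.
Qed.

Lemma harmonic_0 : harmonic 0 = 0.
Proof. unfold harmonic. rewrite sum_n_m_zero by lia. reflexivity. Qed.

Lemma pow_sum_at_0 (c : R) (n : nat) : pow_sum c n 0 = - harmonic n.
Proof.
  induction n as [|n IH]; [rewrite harmonic_0; simpl; ring|].
  cbn [pow_sum]. rewrite IH, harmonic_S, Rmult_0_r, Rminus_0_r, pow1. unfold Rdiv. ring.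
Qed.

Lemma pow_sum_at_inv (c t : R) (n : nat) : c * t = 1 -> pow_sum c n t = 0.
Proof.
  intros H. induction n as [|n IH]; [reflexivity|].
  cbn [pow_sum]. rewrite IH, H, Rminus_diag, pow_i by lia. unfold Rdiv. ring.
Qed.

(** [D] starts at [H_N] and ends at [- ein (- N)]. Its derivative
    [- (exp (- t) - (1 - t / N)^N) / t] lies between [- t exp (- t) / N] and [0], so [D] drops by at
    most [1 / N]. *)
Lemma ein_neg_harmonic (N : nat) :
  (1 <= N)%nat -> - / INR N <= - ein (- INR N) - harmonic N <= 0.
Proof.
  intros HN. assert (HN' : 1 <= INR N) by (apply (le_INR 1); assumption).
  set (c := / INR N).
  set (D := fun t => - ein (- t) - pow_sum c N t).
  set (dD := fun t => expm1_div (- t) - dpow_sum c N t).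
  assert (HD : forall t, is_derive D t (dD t)).
  { intros t. unfold D, dD.
    exact (is_derive_minus _ _ _ _ _ (is_derive_ein_neg t) (is_derive_pow_sum c N t)). }
  assert (Hb : forall t, 0 < t < INR N -> - (t * exp (- t) * c) <= dD t <= 0).
  { intros t Ht. destruct (exp_neg_sub_pow N t HN ltac:(lra)) as [H1 H2].
    assert (E : t * dD t = - (exp (- t) - (1 - t / INR N) ^ N)).
    { unfold dD. rewrite Rmult_minus_distr_l, dpow_sum_spec.
      pose proof (expm1_div_spec (- t)) as E.
      replace (c * t) with (t / INR N) by (unfold c, Rdiv; ring). lra. }
    unfold Rdiv in H1, H2, E. fold c in H1, H2, E.
    split; apply (Rmult_le_reg_l t); lra. }
  assert (H0 : D 0 = harmonic N).
  { unfold D. rewrite Ropp_0, ein_0, pow_sum_at_0. ring. }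
  assert (HDN : D (INR N) = - ein (- INR N)).
  { unfold D. rewrite (pow_sum_at_inv c (INR N)); [ring|]. unfold c. field. lra. }
  split.
  (* [- (1 + t) * exp (- t) * c] is an antiderivative of [t * exp (- t) * c]; adding it to [D] makes
     a nondecreasing function. *)
  - assert (H : D 0 - 1 * c <= D (INR N) - (1 + INR N) * exp (- INR N) * c).
    { replace (D 0 - 1 * c) with (D 0 - (1 + 0) * exp (- 0) * c)
        by (rewrite Ropp_0, exp_0; ring).
      apply (is_derive_nondecreasing (fun t => D t - (1 + t) * exp (- t) * c)
               (fun t => dD t + t * exp (- t) * c)); [lra| |].
      - intros t _.
        assert (H : is_derive (fun t => (1 + t) * exp (- t) * c) t (- (t * exp (- t) * c)))
          by (auto_derive; [trivial|ring]).
        generalize (is_derive_minus _ _ _ _ _ (HD t) H).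
        unfold minus, plus, opp; cbn. rewrite Ropp_involutive. trivial.
      - intros t Ht. specialize (Hb t Ht). lra. }
    assert (0 <= (1 + INR N) * exp (- INR N) * c).
    { unfold c. apply Rmult_le_pos; [apply Rmult_le_pos; [lra|left; apply exp_pos]|].
      left. apply Rinv_0_lt_compat. lra. }
    fold c. lra.
  - assert (H : - D 0 <= - D (INR N)); [|lra].
    apply (is_derive_nondecreasing (fun t => - D t) (fun t => - dD t)); [lra| |].
    + intros t _. apply (is_derive_opp D), HD.
    + intros t Ht. specialize (Hb t Ht). lra.
Qed.

Lemma is_derive_ein_neg_sub_ln (y : R) :
  0 < y -> is_derive (fun t => - ein (- t) - ln t) y (- (exp (- y) / y)).
Proof.
  intros Hy.
  assert (H1 : is_derive ln y (/ y)) by (apply is_derive_Reals, derivable_pt_lim_ln, Hy).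
  replace (- (exp (- y) / y)) with (expm1_div (- y) - / y)
    by (rewrite expm1_div_eq by lra; field; lra).
  exact (is_derive_minus _ _ _ _ _ (is_derive_ein_neg y) H1).
Qed.

(** Up to a constant, [- ein (- t) - ln t] is the tail integral of [exp (- s) / s] from [t]. Its
    derivative [- exp (- t) / t] lies between [- exp (- t)] and [0] once [t >= 1]. *)
Lemma ein_neg_sub_ln_bounds (a b : R) :
  1 <= a <= b ->
  0 <= (- ein (- a) - ln a) - (- ein (- b) - ln b) <= exp (- a).
Proof.
  intros [Ha Hab]. set (g := fun t => - ein (- t) - ln t).
  change (0 <= g a - g b <= exp (- a)). split.
  - assert (- g a <= - g b); [|lra].
    apply (is_derive_nondecreasing (fun t => - g t) (fun t => - - (exp (- t) / t))); [lra| |].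
    + intros t Ht. apply (is_derive_opp g), is_derive_ein_neg_sub_ln. lra.
    + intros t Ht. rewrite Ropp_involutive.
      apply Rdiv_le_0_compat; [left; apply exp_pos|lra].
  - assert (g a - exp (- a) <= g b - exp (- b)).
    { apply (is_derive_nondecreasing (fun t => g t - exp (- t))
              (fun t => - (exp (- t) / t) + exp (- t))); [lra| |].
      - intros t Ht.
        assert (H : is_derive (fun t => exp (- t)) t (- exp (- t)))
          by (auto_derive; [trivial|ring]).
        generalize (is_derive_minus _ _ _ _ _ (is_derive_ein_neg_sub_ln t ltac:(lra)) H).
        unfold minus, plus, opp; cbn. rewrite Ropp_involutive. trivial.
      - intros t Ht. pose proof (exp_pos (- t)) as He.
        assert (exp (- t) / t <= exp (- t)); [|lra].
        apply (Rmult_le_reg_r t); [lra|]. unfold Rdiv.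
        rewrite Rmult_assoc, Rinv_l by lra. nra. }
    pose proof (exp_pos (- b)). lra.
Qed.

(** The constant of integration is identified here. At an integer [N] the function is within [1 / N]
    of [H_N - ln N], so both sequences share a limit; the bounds for real [y] follow from the tail
    estimate. *)
Lemma euler_gamma_ein (y : R) :
  1 <= y -> 0 <= - ein (- y) - ln y - euler_gamma <= exp (- y).
Proof.
  intros Hy. set (g := fun t => - ein (- t) - ln t).
  assert (HS : forall N, 1 <= INR (S N)) by (intros N; apply (le_INR 1); lia).
  assert (HS' : forall N, 1 <= INR (S N) <= INR (S (S N)))
    by (intros N; rewrite (S_INR (S N)); specialize (HS N); lra).
  (* [Lim_seq] is total, so the convergence that gives meaning to [euler_gamma] has to be proved; it
     comes from this decreasing bounded sequence. *)
  destruct (ex_finite_lim_seq_decr (fun N => g (INR (S N))) (g 1 - exp (- (1)))) as [l Hl].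
  { intros N. pose proof (ein_neg_sub_ln_bounds (INR (S N)) (INR (S (S N))) (HS' N)). unfold g. lra. }
  { intros N. pose proof (ein_neg_sub_ln_bounds 1 (INR (S N)) (conj (Rle_refl 1) (HS N))).
    unfold g. lra. }
  assert (El : is_lim_seq (fun N => harmonic N - ln (INR N)) l).
  { apply is_lim_seq_incr_1.
    apply (is_lim_seq_le_le (fun N => g (INR (S N))) _
             (fun N => g (INR (S N)) + / INR (S N))).
    - intros N. pose proof (ein_neg_harmonic (S N) ltac:(lia)). unfold g. lra.
    - exact Hl.
    - replace (Finite l) with (Finite (l + 0)) by (f_equal; ring).
      apply is_lim_seq_plus'; [exact Hl|].
      replace (Finite 0) with (Rbar_inv p_infty) by reflexivity.
      apply is_lim_seq_inv; [|discriminate].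
      apply -> (is_lim_seq_incr_1 INR). apply is_lim_seq_INR. }
  assert (Eg : euler_gamma = l).
  { unfold euler_gamma. rewrite (is_lim_seq_unique _ _ El). reflexivity. }
  rewrite Eg. change (0 <= g y - l <= exp (- y)).
  destruct (nfloor_ex y ltac:(lra)) as [M [_ HM]].
  assert (Hev : forall N, (M <= N)%nat -> 0 <= g y - g (INR (S N)) <= exp (- y)).
  { intros N HN. apply ein_neg_sub_ln_bounds. split; [exact Hy|].
    rewrite S_INR. apply le_INR in HN. lra. }
  split.
  - assert (Rbar_le l (g y)); [|simpl in *; lra].
    apply (is_lim_seq_le_loc (fun N => g (INR (S N))) (fun _ => g y));
      [|exact Hl|apply is_lim_seq_const].
    exists M. intros N HN. specialize (Hev N HN). lra.
  - assert (Rbar_le (g y - exp (- y)) l); [|simpl in *; lra].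
    apply (is_lim_seq_le_loc (fun _ => g y - exp (- y)) (fun N => g (INR (S N))));
      [|apply is_lim_seq_const|exact Hl].
    exists M. intros N HN. specialize (Hev N HN). lra.
Qed.

Definition ei_primitive (x : R) : R := ln (Rabs x) + ein x.

Lemma is_derive_ei_primitive (x : R) :
  x <> 0 -> is_derive ei_primitive x (exp x / x) /\ continuous (fun t => exp t / t) x.
Proof.
  intros Hx. split.
  - assert (H : is_derive (fun t => ln (Rabs t)) x (/ x)).
    { destruct (Rdichotomy _ _ Hx) as [H|H].
      - apply (is_derive_ext_loc (fun t => ln (- t))).
        + apply (filter_imp (fun t => t < 0)); [|apply (open_lt 0), H].
          intros t Ht. rewrite Rabs_left by assumption. reflexivity.
        + auto_derive; [lra|field; lra].
      - apply (is_derive_ext_loc ln).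
        + apply (filter_imp (fun t => 0 < t)); [|apply (open_gt 0), H].
          intros t Ht. rewrite Rabs_pos_eq by lra. reflexivity.
        + apply is_derive_Reals, derivable_pt_lim_ln, H. }
    replace (exp x / x) with (/ x + expm1_div x) by (rewrite expm1_div_eq by assumption; field; assumption).
    exact (is_derive_plus _ _ _ _ _ H (is_derive_ein x)).
  - apply (ex_derive_continuous (fun t => exp t / t)). auto_derive. exact Hx.
Qed.

Lemma ei_primitive_m_infty :
  filterlim ei_primitive (Rbar_locally m_infty) (locally (- euler_gamma)).
Proof.
  apply (is_lim_le_le_loc (fun x => - euler_gamma - exp x) (fun _ => - euler_gamma)
           ei_primitive m_infty (- euler_gamma)).
  - exists (-1). intros x Hx. pose proof (euler_gamma_ein (- x) ltac:(lra)) as H.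
    rewrite Ropp_involutive in H. unfold ei_primitive.
    rewrite Rabs_left by lra. lra.
  - replace (Finite (- euler_gamma)) with (Finite (- euler_gamma - 0)) by (f_equal; ring).
    apply (is_lim_minus' (fun _ => - euler_gamma) exp m_infty (- euler_gamma) 0).
    + apply is_lim_const.
    + apply is_lim_exp_m.
  - apply is_lim_const.
Qed.

Lemma is_RInt_gen_ei (x : R) :
  x < 0 ->
  is_RInt_gen (fun t => exp t / t) (Rbar_locally m_infty) (at_point x)
    (ei_primitive x + euler_gamma).
Proof.
  intros Hx.
  replace (ei_primitive x + euler_gamma) with (ei_primitive x - - euler_gamma) by ring.
  apply (is_RInt_gen_antiderivative ei_primitive).
  - exists (fun a => a < 0) (fun b => b = x).
    + exists 0. auto.
    + reflexivity.
    + intros a b Ha -> t [_ Ht]. simpl in Ht. apply is_derive_ei_primitive.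
      assert (Rmax a x < 0) by (apply Rmax_lub_lt; assumption). lra.
  - apply ei_primitive_m_infty.
  - intros P HP. apply (locally_singleton _ _ HP).
Qed.

Lemma Ei_series (x : R) : x <> 0 -> Ei x = euler_gamma + ln (Rabs x) + ein x.
Proof.
  intros Hx. unfold Ei. destruct (Rlt_dec x 0) as [H|H].
  - apply is_RInt_gen_unique.
    replace (euler_gamma + ln (Rabs x) + ein x) with (ei_primitive x + euler_gamma)
      by (unfold ei_primitive; ring).
    apply is_RInt_gen_ei, H.
  - assert (Hp : 0 < x) by lra.
    apply (iota_filterlim_locally (V := R_CompleteNormedModule)).
    (* [ln (Rabs t)] is even, so the logarithms at [- eps] and [eps] cancel; only
       [ein (- eps) - ein eps] depends on [eps], and it tends to [0]. *)
    apply (filterlim_ext_loc (fun eps => ei_primitive x + euler_gamma + (ein (- eps) - ein eps))).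
    { exists (mkposreal 1 Rlt_0_1). intros eps _ He.
      assert (E1 : RInt_gen (fun t => exp t / t) (Rbar_locally m_infty) (at_point (- eps))
                   = ei_primitive (- eps) + euler_gamma)
        by (apply is_RInt_gen_unique, is_RInt_gen_ei; lra).
      rewrite E1.
      assert (E : is_RInt (fun t => exp t / t) eps x (ei_primitive x - ei_primitive eps)).
      { apply (is_RInt_derive ei_primitive); intros t [Ht _];
          apply is_derive_ei_primitive;
          assert (0 < Rmin eps x) by (apply Rmin_glb_lt; assumption); lra. }
      rewrite (is_RInt_unique _ _ _ _ E).
      unfold ei_primitive. rewrite Rabs_Ropp. ring. }
    replace (euler_gamma + ln (Rabs x) + ein x)
      with (ei_primitive x + euler_gamma + (ein (- 0) - ein 0))
      by (unfold ei_primitive; rewrite Ropp_0; ring).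
    eapply filterlim_filter_le_1; [apply filter_le_within|].
    apply (ex_derive_continuous
      (fun eps => ei_primitive x + euler_gamma + (ein (- eps) - ein eps))).
    assert (D : forall t, ex_derive ein t) by (intros t; eexists; apply is_derive_ein).
    auto_derive. auto.
Qed.

(** * Identity theorem along a ray *)

Lemma Rbar_lt_CV_radius (a : nat -> R) (r x : R) :
  (forall y, Rabs y < r -> ex_pseries a y) -> Rabs x < r ->
  Rbar_lt (Rabs x) (CV_radius a).
Proof.
  intros H Hx. apply (Rbar_lt_le_trans _ ((Rabs x + r) / 2)); [simpl; lra|].
  apply Rbar_not_lt_le. intros Hlt.
  pose proof (Rabs_pos x) as Hx0.
  rewrite <- (Rabs_pos_eq ((Rabs x + r) / 2)) in Hlt by lra.
  apply (CV_disk_outside a _ Hlt).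
  apply ex_series_lim_0, ex_pseries_R, H. rewrite Rabs_pos_eq; lra.
Qed.

Lemma PSeries_zero_left_0 (a : nat -> R) (r : R) :
  0 < r -> (forall y, Rabs y < r -> ex_pseries a y) ->
  (forall y, - r < y < 0 -> PSeries a y = 0) -> a 0%nat = 0.
Proof.
  intros Hr Hex Hz.
  assert (Hc : continuous (PSeries a) 0).
  { apply continuity_pt_filterlim, PSeries_continuity.
    apply (Rbar_lt_CV_radius a r); [exact Hex|rewrite Rabs_R0; exact Hr]. }
  rewrite <- (PSeries_0 a).
  apply (filterlim_locally_unique (F := at_left 0) (PSeries a)).
  - eapply filterlim_filter_le_1; [apply filter_le_within|exact Hc].
  - apply (filterlim_ext_loc (fun _ => 0)); [|apply filterlim_const].
    exists (mkposreal r Hr). intros y Hy Hy0. symmetry. apply Hz.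
    change (Rabs (y - 0) < r) in Hy. apply Rabs_def2 in Hy. lra.
Qed.

(** Once the constant term is known to be [0], dividing by [y] leaves a series with the same zeros.
    Zeros to the left of [0] suffice, which fits both the supremum argument and a differential
    equation stated only for [x < 0]. *)
Lemma PSeries_zero_left (k : nat) (a : nat -> R) (r : R) :
  0 < r -> (forall y, Rabs y < r -> ex_pseries a y) ->
  (forall y, - r < y < 0 -> PSeries a y = 0) -> a k = 0.
Proof.
  revert a. induction k as [|k IH]; intros a Hr Hex Hz.
  - exact (PSeries_zero_left_0 a r Hr Hex Hz).
  - pose proof (PSeries_zero_left_0 a r Hr Hex Hz) as H0.
    apply (IH (PS_decr_1 a)); [exact Hr| |].
    + intros y Hy. apply CV_radius_inside. rewrite CV_radius_decr_1.
      apply (Rbar_lt_CV_radius a r); assumption.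
    + intros y Hy. pose proof (PSeries_decr_1_aux a y H0) as E.
      rewrite Hz in E by exact Hy. symmetry in E.
      destruct (Rmult_integral _ _ E); [lra|assumption].
Qed.

(** Let [S] be the supremum of the [t] for which [h] vanishes on [[0, t]]. The expansion at [S]
    vanishes to the left, so it is zero and [h] vanishes around [S]; this forces [S = 1] and
    [h 1 = 0]. *)
Lemma real_analytic_zero_extend (h : R -> R) (e : R) :
  (forall s0, 0 <= s0 <= 1 -> exists (a : nat -> R) (r : R), 0 < r /\
     forall s, Rabs (s - s0) < r -> is_pseries a (s - s0) (h s)) ->
  0 < e -> (forall s, 0 <= s < e -> h s = 0) -> h 1 = 0.
Proof.
  intros Han He Hz.
  set (A := fun t => 0 <= t <= 1 /\ forall s, 0 <= s <= t -> h s = 0).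
  destruct (completeness A) as [S [Hub Hlub]].
  { exists 1. intros t [Ht _]. lra. }
  { exists 0. split; [lra|]. intros s Hs. apply Hz. lra. }
  assert (HS1 : S <= 1) by (apply Hlub; intros t [Ht _]; lra).
  assert (HS0 : 0 < S).
  { apply Rlt_le_trans with (Rmin 1 (e / 2)); [apply Rmin_glb_lt; lra|].
    apply Hub. pose proof (Rmin_l 1 (e / 2)). pose proof (Rmin_r 1 (e / 2)).
    split; [split; [apply Rmin_glb; lra|assumption]|].
    intros s Hs. apply Hz. lra. }
  assert (Hbelow : forall s, 0 <= s < S -> h s = 0).
  { intros s Hs.
    destruct (Classical_Prop.classic (exists t, A t /\ s <= t)) as [[t [[_ Ht] Hst]]|Hn].
    - apply Ht. lra.
    - exfalso. assert (S <= s); [|lra]. apply Hlub. intros t Ht.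
      destruct (Rle_lt_dec t s) as [H|H]; [exact H|]. exfalso. apply Hn.
      exists t. split; [exact Ht|lra]. }
  destruct (Han S ltac:(lra)) as [a [r [Hr Ha]]].
  assert (Ha' : forall y, Rabs y < r -> is_pseries a y (h (S + y))).
  { intros y Hy. replace y with ((S + y) - S) at 1 by ring. apply Ha.
    replace (S + y - S) with y by ring. exact Hy. }
  assert (Hak : forall k, a k = 0).
  { intros k. apply (PSeries_zero_left k a (Rmin r S)).
    - apply Rmin_glb_lt; assumption.
    - intros y Hy. eexists. apply Ha'. pose proof (Rmin_l r S). lra.
    - intros y Hy. pose proof (Rmin_l r S). pose proof (Rmin_r r S).
      rewrite (is_pseries_unique _ _ _ (Ha' y ltac:(rewrite Rabs_left; lra))).
      apply Hbelow. lra. }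
  assert (Hnear : forall y, Rabs y < r -> h (S + y) = 0).
  { intros y Hy. rewrite <- (is_pseries_unique _ _ _ (Ha' y Hy)).
    rewrite (PSeries_ext a (fun _ => 0) y Hak). apply PSeries_const_0. }
  destruct (Req_dec S 1) as [E|Hne].
  - rewrite <- E. replace S with (S + 0) by ring. apply Hnear. rewrite Rabs_R0. exact Hr.
  - exfalso. set (t := Rmin 1 (S + r / 2)).
    assert (S < t) by (apply Rmin_glb_lt; lra).
    pose proof (Rmin_l 1 (S + r / 2)). pose proof (Rmin_r 1 (S + r / 2)). fold t in H0, H1.
    assert (t <= S); [|lra]. apply Hub. split; [lra|].
    intros s Hs. destruct (Rlt_le_dec s S) as [Hlt|Hge]; [apply Hbelow; lra|].
    replace s with (S + (s - S)) by ring. apply Hnear. rewrite Rabs_pos_eq; lra.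
Qed.

Lemma sum_n_Re (a : nat -> C) (N : nat) :
  Re (sum_n (G := C_AbelianMonoid) a N) = sum_n (fun k => Re (a k)) N.
Proof.
  induction N as [|N IH]; [rewrite !sum_O; reflexivity|].
  rewrite !sum_Sn, <- IH. reflexivity.
Qed.

Lemma sum_n_Im (a : nat -> C) (N : nat) :
  Im (sum_n (G := C_AbelianMonoid) a N) = sum_n (fun k => Im (a k)) N.
Proof.
  induction N as [|N IH]; [rewrite !sum_O; reflexivity|].
  rewrite !sum_Sn, <- IH. reflexivity.
Qed.

Lemma im_le_Cmod (c : C) : Rabs (Im c) <= Cmod c.
Proof. eapply Rle_trans; [apply Rmax_r|apply Rmax_Cmod]. Qed.

Lemma Cmod_le_Re_Im (c : C) : Cmod c <= Rabs (Re c) + Rabs (Im c).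
Proof.
  replace c with (RtoC (Re c) + Ci * RtoC (Im c))%C at 1.
  - eapply Rle_trans; [apply Cmod_triangle|].
    rewrite Cmod_mult, !Cmod_R, Cmod_Ci. lra.
  - destruct c as [x y]. unfold Ci, RtoC, Cmult, Cplus, Re, Im; simpl. f_equal; ring.
Qed.

Lemma is_series_C_Re_Im (a : nat -> C) (l : C) :
  is_series (K := C_AbsRing) (V := C_NormedModule) a l ->
  is_series (fun k => Re (a k)) (Re l) /\ is_series (fun k => Im (a k)) (Im l).
Proof.
  intros H.
  pose proof (proj1 (filterlim_locally_ball_norm (K := C_AbsRing) (U := C_NormedModule) _ _) H) as H'.
  split; apply (proj2 (filterlim_locally _ _)); intros eps;
    generalize (H' eps); apply filter_imp; intros N HN.
  - rewrite <- sum_n_Re. change (Rabs (Re (sum_n (G := C_AbelianMonoid) a N) - Re l) < eps).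
    eapply Rle_lt_trans; [|exact HN].
    apply (re_le_Cmod (sum_n (G := C_AbelianMonoid) a N - l)%C).
  - rewrite <- sum_n_Im. change (Rabs (Im (sum_n (G := C_AbelianMonoid) a N) - Im l) < eps).
    eapply Rle_lt_trans; [|exact HN].
    apply (im_le_Cmod (sum_n (G := C_AbelianMonoid) a N - l)%C).
Qed.

Lemma pow_n_C (z : C) (k : nat) : pow_n (K := C_Ring) z k = (z ^ k)%C.
Proof.
  induction k as [|k IH]; [reflexivity|]. simpl. rewrite IH. reflexivity.
Qed.

(** Since [s Z - s0 Z = (s - s0) Z], the powers of [Z] move into the coefficients and the variable
    becomes real. *)
Lemma analytic_on_ray (F : C -> C) (Z : C) (s0 : R) :
  analytic_at F (s0 * Z)%C ->
  exists (u : nat -> C) (r : R), 0 < r /\ forall s, Rabs (s - s0) < r ->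
    is_pseries (fun k => Re (u k)) (s - s0) (Re (F (s * Z)%C)) /\
    is_pseries (fun k => Im (u k)) (s - s0) (Im (F (s * Z)%C)).
Proof.
  intros [u [r [Hr H]]].
  assert (HZ : 0 < Cmod Z + 1) by (pose proof (Cmod_ge_0 Z); lra).
  (* Dividing by [Cmod Z + 1] rather than [Cmod Z] covers [Z = 0]. *)
  exists (fun k => (Z ^ k * u k)%C), (r / (Cmod Z + 1)).
  split; [apply Rdiv_lt_0_compat; assumption|].
  intros s Hs.
  assert (Ez : (s * Z - s0 * Z = RtoC (s - s0) * Z)%C)
    by (rewrite RtoC_minus; ring).
  assert (Hz : Cmod (s * Z - s0 * Z)%C < r).
  { rewrite Ez, Cmod_mult, Cmod_R. pose proof (Rabs_pos (s - s0)).
    apply (Rmult_lt_compat_r (Cmod Z + 1)) in Hs; [|assumption].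
    unfold Rdiv in Hs. rewrite Rmult_assoc, Rinv_l in Hs by lra. nra. }
  specialize (H _ Hz). rewrite Ez in H. unfold is_pseries in H.
  destruct (is_series_C_Re_Im _ _ H) as [HRe HIm].
  assert (E : forall k, scal (pow_n (K := C_Ring) (RtoC (s - s0) * Z)%C k) (u k)
              = (RtoC ((s - s0) ^ k) * (Z ^ k * u k))%C).
  { intros k. rewrite pow_n_C, Cpow_mult_l, <- RtoC_pow.
    change (((RtoC ((s - s0) ^ k) * Z ^ k) * u k)%C = (RtoC ((s - s0) ^ k) * (Z ^ k * u k))%C).
    ring. }
  split; apply PSeries.is_pseries_R; [revert HRe|revert HIm]; apply is_series_ext;
    intros k; rewrite E.
  - rewrite re_scal_l. eqR. ring.
  - unfold Im, RtoC, Cmult; simpl. eqR. ring.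
Qed.

Lemma analytic_eq_along_ray (F G : C -> C) (Z : C) (e : R) :
  (forall s, 0 <= s <= 1 -> analytic_at F (s * Z)%C) ->
  (forall s, 0 <= s <= 1 -> analytic_at G (s * Z)%C) ->
  0 < e -> (forall s, 0 <= s < e -> F (s * Z)%C = G (s * Z)%C) -> F Z = G Z.
Proof.
  intros HF HG He Heq.
  assert (EZ : (RtoC 1 * Z)%C = Z) by ring.
  assert (Hre : Re (F (RtoC 1 * Z)%C) - Re (G (RtoC 1 * Z)%C) = 0).
  { apply (real_analytic_zero_extend (fun s => Re (F (s * Z)%C) - Re (G (s * Z)%C)) e).
    - intros s0 Hs0.
      destruct (analytic_on_ray F Z s0 (HF s0 Hs0)) as [u [r [Hr Hu]]].
      destruct (analytic_on_ray G Z s0 (HG s0 Hs0)) as [v [r' [Hr' Hv]]].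
      exists (PS_minus (fun k => Re (u k)) (fun k => Re (v k))), (Rmin r r').
      split; [apply Rmin_glb_lt; assumption|]. intros s Hs.
      apply (is_pseries_minus (K := R_AbsRing) (V := R_NormedModule)); [apply Hu|apply Hv];
        pose proof (Rmin_l r r'); pose proof (Rmin_r r r'); lra.
    - exact He.
    - intros s Hs. rewrite Heq by exact Hs. ring. }
  assert (Him : Im (F (RtoC 1 * Z)%C) - Im (G (RtoC 1 * Z)%C) = 0).
  { apply (real_analytic_zero_extend (fun s => Im (F (s * Z)%C) - Im (G (s * Z)%C)) e).
    - intros s0 Hs0.
      destruct (analytic_on_ray F Z s0 (HF s0 Hs0)) as [u [r [Hr Hu]]].
      destruct (analytic_on_ray G Z s0 (HG s0 Hs0)) as [v [r' [Hr' Hv]]].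
      exists (PS_minus (fun k => Im (u k)) (fun k => Im (v k))), (Rmin r r').
      split; [apply Rmin_glb_lt; assumption|]. intros s Hs.
      apply (is_pseries_minus (K := R_AbsRing) (V := R_NormedModule)); [apply Hu|apply Hv];
        pose proof (Rmin_l r r'); pose proof (Rmin_r r r'); lra.
    - exact He.
    - intros s Hs. rewrite Heq by exact Hs. ring. }
  rewrite EZ in Hre, Him.
  apply injective_projections; [unfold Re in Hre|unfold Im in Him]; lra.
Qed.

(** The segment from [0] to a nonreal [z] meets the real axis only at [0], so it avoids the cut; on
    its part inside the unit disc both functions are the Gauss series. Limits on the cut only see
    nonreal points. *)
Lemma is_hyp2F1_unique (a b c : R) (F G : C -> C) :
  is_hyp2F1 a b c F -> is_hyp2F1 a b c G ->
  forall z, Im z <> 0 -> F z = G z.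
Proof.
  intros [F1 F2] [G1 G2] z Hz.
  assert (Hcut : forall s, 0 <= s <= 1 -> ~ (Im (s * z)%C = 0 /\ 1 <= Re (s * z)%C)).
  { intros s Hs [H1 H2]. unfold Im, Re, RtoC, Cmult in *; simpl in *.
    destruct (Req_dec s 0) as [->|Hs0]; [lra|].
    apply Hz. apply (Rmult_eq_reg_l s); lra. }
  assert (Hp : 0 < Cmod z).
  { apply Cmod_gt_0. intros ->. apply Hz. reflexivity. }
  apply (analytic_eq_along_ray F G z (/ Cmod z)).
  - intros s Hs. apply F2, Hcut, Hs.
  - intros s Hs. apply G2, Hcut, Hs.
  - apply Rinv_0_lt_compat, Hp.
  - intros s Hs.
    assert (Hm : Cmod (s * z)%C < 1).
    { rewrite Cmod_mult, Cmod_R, Rabs_pos_eq by lra.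
      rewrite <- (Rinv_l (Cmod z)) by lra. apply Rmult_lt_compat_r; lra. }
    apply (filterlim_locally_unique (K := C_AbsRing) (V := C_NormedModule) _ _ _ (F1 _ Hm) (G1 _ Hm)).
Qed.

(** * Euler's integral for the hypergeometric function *)

Definition C_cont (f : R -> C) : Prop :=
  forall t, 0 <= t <= 1 ->
    continuous (fun s => Re (f s)) t /\ continuous (fun s => Im (f s)) t.

Definition CInt (f : R -> C) : C :=
  (RInt (fun t => Re (f t)) 0 1, RInt (fun t => Im (f t)) 0 1).

Lemma C_cont_RtoC (w : R -> R) : (forall t, continuous w t) -> C_cont (fun t => RtoC (w t)).
Proof. intros H t _. split; [apply H|apply continuous_const]. Qed.

Lemma C_cont_const (c : C) : C_cont (fun _ => c).
Proof. intros t _. split; apply continuous_const. Qed.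

Lemma C_cont_minus (f g : R -> C) :
  C_cont f -> C_cont g -> C_cont (fun t => (f t - g t)%C).
Proof.
  intros Hf Hg t Ht. destruct (Hf t Ht), (Hg t Ht).
  split; apply (continuous_minus (V := R_NormedModule)); assumption.
Qed.

Lemma C_cont_mult (f g : R -> C) :
  C_cont f -> C_cont g -> C_cont (fun t => (f t * g t)%C).
Proof.
  intros Hf Hg t Ht. destruct (Hf t Ht), (Hg t Ht).
  split; [apply (continuous_minus (V := R_NormedModule))
         |apply (continuous_plus (V := R_NormedModule))];
    apply (continuous_mult (K := R_AbsRing)); assumption.
Qed.

Lemma C_cont_pow (f : R -> C) (k : nat) : C_cont f -> C_cont (fun t => (f t ^ k)%C).
Proof.
  intros Hf. induction k as [|k IH]; [exact (C_cont_const 1)|].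
  apply (C_cont_mult f (fun t => (f t ^ k)%C) Hf IH).
Qed.

Lemma Re_Im_sqr_neq_0 (c : C) : c <> 0 -> Re c ^ 2 + Im c ^ 2 <> 0.
Proof.
  intros Hc H. apply Hc. pose proof (pow2_ge_0 (Re c)). pose proof (pow2_ge_0 (Im c)).
  apply injective_projections; [change (Re c = 0)|change (Im c = 0)]; nra.
Qed.

Lemma C_cont_inv (f : R -> C) :
  (forall t, 0 <= t <= 1 -> f t <> 0) -> C_cont f -> C_cont (fun t => (/ f t)%C).
Proof.
  intros H0 Hf t Ht. destruct (Hf t Ht) as [H1 H2].
  assert (Hq : continuous (fun s => / (Re (f s) ^ 2 + Im (f s) ^ 2)) t).
  { apply continuous_Rinv_comp; [|apply Re_Im_sqr_neq_0, H0, Ht].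
    simpl. apply (continuous_plus (V := R_NormedModule));
      (apply (continuous_mult (K := R_AbsRing)); [assumption|]);
      (apply (continuous_mult (K := R_AbsRing)); [assumption|apply continuous_const]). }
  split; apply (continuous_mult (K := R_AbsRing)); try assumption.
  apply (continuous_opp (V := R_NormedModule)); assumption.
Qed.

Lemma C_cont_ex_RInt (f : R -> C) :
  C_cont f -> ex_RInt (fun t => Re (f t)) 0 1 /\ ex_RInt (fun t => Im (f t)) 0 1.
Proof.
  intros Hf. split; apply (ex_RInt_continuous (V := R_CompleteNormedModule));
    intros t Ht; rewrite Rmin_left, Rmax_right in Ht by lra; apply Hf, Ht.
Qed.

Lemma CInt_ext (f g : R -> C) :
  (forall t, 0 <= t <= 1 -> f t = g t) -> CInt f = CInt g.
Proof.
  intros H. unfold CInt.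
  f_equal; apply RInt_ext; intros t Ht; rewrite Rmin_left, Rmax_right in Ht by lra;
    rewrite H by lra; reflexivity.
Qed.

Lemma CInt_minus (f g : R -> C) :
  C_cont f -> C_cont g -> CInt (fun t => (f t - g t)%C) = (CInt f - CInt g)%C.
Proof.
  intros Hf Hg. destruct (C_cont_ex_RInt f Hf), (C_cont_ex_RInt g Hg).
  unfold CInt. apply injective_projections; simpl;
    apply (RInt_minus (V := R_CompleteNormedModule)); assumption.
Qed.

Lemma CInt_scal (c : C) (f : R -> C) :
  C_cont f -> CInt (fun t => (c * f t)%C) = (c * CInt f)%C.
Proof.
  intros Hf. destruct (C_cont_ex_RInt f Hf) as [H1 H2].
  apply (RInt_correct (V := R_CompleteNormedModule)) in H1, H2.
  apply injective_projections; apply (is_RInt_unique (V := R_CompleteNormedModule)).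
  - exact (is_RInt_minus (V := R_NormedModule) _ _ 0 1 _ _
      (is_RInt_scal (V := R_NormedModule) _ 0 1 (Re c) _ H1)
      (is_RInt_scal (V := R_NormedModule) _ 0 1 (Im c) _ H2)).
  - exact (is_RInt_plus (V := R_NormedModule) _ _ 0 1 _ _
      (is_RInt_scal (V := R_NormedModule) _ 0 1 (Re c) _ H2)
      (is_RInt_scal (V := R_NormedModule) _ 0 1 (Im c) _ H1)).
Qed.

Lemma CInt_RtoC (w : R -> R) : CInt (fun t => RtoC (w t)) = RtoC (RInt w 0 1).
Proof.
  unfold CInt, RtoC, Re, Im; simpl. f_equal.
  rewrite (RInt_const (V := R_CompleteNormedModule)). apply Rmult_0_r.
Qed.

(** Real and imaginary parts are bounded separately, whence the factor [2]; it is harmless for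
    remainders that tend to [0]. *)
Lemma CInt_bound (f : R -> C) (M : R) :
  C_cont f -> (forall t, 0 <= t <= 1 -> Cmod (f t) <= M) -> Cmod (CInt f) <= 2 * M.
Proof.
  intros Hf HM. destruct (C_cont_ex_RInt f Hf) as [H1 H2].
  eapply Rle_trans; [apply Cmod_le_Re_Im|]. unfold CInt. simpl Re; simpl Im.
  assert (B : forall g, ex_RInt g 0 1 -> (forall t, 0 <= t <= 1 -> Rabs (g t) <= M) ->
              Rabs (RInt g 0 1) <= M).
  { intros g Hg Hb. pose proof (abs_RInt_le_const g 0 1 M ltac:(lra) Hg Hb). lra. }
  pose proof (B _ H1 (fun t Ht => Rle_trans _ _ _ (re_le_Cmod _) (HM t Ht))).
  pose proof (B _ H2 (fun t Ht => Rle_trans _ _ _ (im_le_Cmod _) (HM t Ht))).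
  lra.
Qed.

Lemma C_cont_one_minus (z : C) : C_cont (fun t => (1 - z * RtoC t)%C).
Proof.
  apply C_cont_minus; [apply C_cont_const|].
  apply C_cont_mult; [apply C_cont_const|apply C_cont_RtoC; intros t; apply continuous_id].
Qed.

Lemma C_cont_cauchy_kernel (w : R -> R) (z : C) (k : nat) :
  (forall t, continuous w t) -> (forall t, 0 <= t <= 1 -> (1 - z * RtoC t)%C <> 0) ->
  C_cont (fun t => (RtoC (w t) / (1 - z * RtoC t) ^ k)%C).
Proof.
  intros Hw Hz. apply C_cont_mult; [apply C_cont_RtoC, Hw|].
  apply C_cont_inv; [intros t Ht; apply Cpow_nz, Hz, Ht|].
  apply C_cont_pow, C_cont_one_minus.
Qed.

Lemma continuous_mult_pow (w : R -> R) (k : nat) :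
  (forall t, continuous w t) -> forall t, continuous (fun s => w s * s ^ k) t.
Proof.
  intros Hw t. apply (continuous_mult (K := R_AbsRing)); [apply Hw|].
  apply (ex_derive_continuous (fun s => s ^ k)). auto_derive. trivial.
Qed.

Lemma one_minus_neq_0 (z : C) (d : R) :
  0 < d -> (forall t, 0 <= t <= 1 -> d <= Cmod (1 - z * RtoC t)%C) ->
  forall t, 0 <= t <= 1 -> (1 - z * RtoC t)%C <> 0.
Proof.
  intros Hd H t Ht E. specialize (H t Ht). rewrite E, Cmod_0 in H. lra.
Qed.

(** Geometric expansion about [z0] of the kernel [1 / (1 - z t)], in powers of
    [(z - z0) t / (1 - z0 t)]. *)
Lemma is_pseries_cauchy (w : R -> R) (z0 z : C) (d : R) :
  (forall t, continuous w t) -> 0 < d ->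
  (forall t, 0 <= t <= 1 -> d <= Cmod (1 - z0 * RtoC t)%C) -> Cmod (z - z0)%C < d ->
  is_pseries (K := C_AbsRing) (V := C_NormedModule)
    (fun k => CInt (fun t => RtoC (w t * t ^ k) / (1 - z0 * RtoC t) ^ S k)%C)
    (z - z0)%C (CInt (fun t => RtoC (w t) / (1 - z * RtoC t) ^ 1)%C).
Proof.
  intros Hw Hd Hz0 Hz. set (e := d - Cmod (z - z0)%C).
  assert (He : 0 < e) by (unfold e; lra).
  (* Passing from [z0] to [z] changes [1 - z t] by at most [|z - z0|], so a margin [e] is left. *)
  assert (Hz1 : forall t, 0 <= t <= 1 -> e <= Cmod (1 - z * RtoC t)%C).
  { intros t Ht. specialize (Hz0 t Ht).
    replace (1 - z0 * RtoC t)%C with ((1 - z * RtoC t) + (z - z0) * RtoC t)%C in Hz0 by ring.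
    pose proof (Cmod_triangle (1 - z * RtoC t) ((z - z0) * RtoC t)) as H.
    rewrite Cmod_mult, Cmod_R, Rabs_pos_eq in H by lra.
    pose proof (Cmod_ge_0 (z - z0)%C). unfold e. nra. }
  pose proof (one_minus_neq_0 z0 d Hd Hz0) as N0.
  pose proof (one_minus_neq_0 z e He Hz1) as N1.
  set (q := fun t => ((z - z0) * RtoC t / (1 - z0 * RtoC t))%C).
  assert (Cq : C_cont q).
  { apply C_cont_mult; [apply C_cont_mult; [apply C_cont_const|]|].
    - apply C_cont_RtoC; intros t; apply continuous_id.
    - apply C_cont_inv; [exact N0|apply C_cont_one_minus]. }
  (* The integrand of the exact remainder after [N] terms. As [1 - q = (1 - z t) / (1 - z0 t)], the
     [k]-th term of the series is the difference of the remainders at [k] and [S k], and partial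
     sums telescope. *)
  set (rem := fun N t => (RtoC (w t) / (1 - z * RtoC t) ^ 1 * q t ^ N)%C).
  assert (Crem : forall N, C_cont (rem N)).
  { intros N. apply C_cont_mult; [apply C_cont_cauchy_kernel; assumption|].
    apply C_cont_pow, Cq. }
  assert (Eterm : forall k, scal (pow_n (K := C_Ring) (z - z0)%C k)
      (CInt (fun t => RtoC (w t * t ^ k) / (1 - z0 * RtoC t) ^ S k)%C)
      = (CInt (rem k) - CInt (rem (S k)))%C).
  { intros k. rewrite pow_n_C.
    change (((z - z0) ^ k * CInt (fun t => RtoC (w t * t ^ k) / (1 - z0 * RtoC t) ^ S k))%C
            = (CInt (rem k) - CInt (rem (S k)))%C).
    rewrite <- CInt_scal
      by (apply C_cont_cauchy_kernel; [apply continuous_mult_pow, Hw|exact N0]).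
    rewrite <- CInt_minus by apply Crem.
    apply CInt_ext. intros t Ht. unfold rem, q, Cdiv.
    rewrite !Cpow_S, !Cpow_mult_l, RtoC_mult, RtoC_pow, !Cpow_inv by (apply N0, Ht).
    specialize (N0 t Ht). specialize (N1 t Ht). simpl Cpow. 
    field. auto using Cpow_nz. }
  assert (Esum : forall N, sum_n (fun k => scal (pow_n (K := C_Ring) (z - z0)%C k)
      (CInt (fun t => RtoC (w t * t ^ k) / (1 - z0 * RtoC t) ^ S k)%C)) N
      = (CInt (rem 0%nat) - CInt (rem (S N)))%C).
  { induction N as [|N IH]; [rewrite sum_O; apply Eterm|].
    rewrite sum_Sn, IH, Eterm.
    change ((CInt (rem 0%nat) - CInt (rem (S N)) + (CInt (rem (S N)) - CInt (rem (S (S N)))))%C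
            = (CInt (rem 0%nat) - CInt (rem (S (S N))))%C).
    ring. }
  assert (E0 : CInt (fun t => RtoC (w t) / (1 - z * RtoC t) ^ 1)%C = CInt (rem 0%nat)).
  { apply CInt_ext. intros t _. unfold rem. simpl. ring. }
  rewrite E0.
  destruct (continuity_ab_maj (fun t => Rabs (w t)) 0 1 ltac:(lra)) as [tm [HW _]].
  { intros t _. apply continuity_pt_filterlim.
    apply (continuous_comp w Rabs); [apply Hw|apply continuous_Rabs]. }
  set (W := Rabs (w tm)) in HW.
  set (p := Cmod (z - z0)%C / d).
  assert (Hp : 0 <= p < 1).
  { unfold p. split; [apply Rdiv_le_0_compat; [apply Cmod_ge_0|assumption]|].
    apply (Rmult_lt_reg_r d); [assumption|]. unfold Rdiv.
    rewrite Rmult_assoc, Rinv_l; lra. }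
  assert (Hrem : forall N, Cmod (CInt (rem N)) <= 2 * (W / e * p ^ N)).
  { intros N. apply CInt_bound; [apply Crem|]. intros t Ht. unfold rem, Cdiv.
    assert (E1 : ((1 - z * RtoC t) ^ 1)%C = (1 - z * RtoC t)%C) by (simpl; ring).
    rewrite E1, !Cmod_mult, Cmod_pow, Cmod_inv, Cmod_R by (apply N1, Ht).
    assert (Hq : Cmod (q t) <= p).
    { unfold q, p, Cdiv. rewrite !Cmod_mult, Cmod_inv, Cmod_R, Rabs_pos_eq by (try lra; apply N0, Ht).
      specialize (Hz0 t Ht). pose proof (Cmod_ge_0 (z - z0)%C).
      unfold Rdiv. apply Rmult_le_compat; [nra| |nra|apply Rinv_le_contravar; lra].
      left; apply Rinv_0_lt_compat; lra. }
    specialize (Hz1 t Ht).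
    apply Rmult_le_compat; [|apply pow_le, Cmod_ge_0| |apply pow_incr; split; [apply Cmod_ge_0|exact Hq]].
    - apply Rmult_le_pos; [apply Rabs_pos|left; apply Rinv_0_lt_compat; lra].
    - apply Rmult_le_compat; [apply Rabs_pos|left; apply Rinv_0_lt_compat; lra
        |apply HW, Ht|apply Rinv_le_contravar; lra]. }
  assert (Hlim : is_lim_seq (fun N => 2 * (W / e * p ^ S N)) 0).
  { replace (Finite 0) with (Rbar_mult (2 * (W / e)) 0) by (simpl; f_equal; ring).
    apply (is_lim_seq_ext (fun N => 2 * (W / e) * p ^ S N)); [intros N; ring|].
    apply is_lim_seq_scal_l.
    apply -> (is_lim_seq_incr_1 (fun N => p ^ N)).
    apply is_lim_seq_geom. rewrite Rabs_pos_eq; lra. }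
  apply (proj2 (filterlim_locally_ball_norm (K := C_AbsRing) (U := C_NormedModule) _ _)).
  intros eps.
  generalize (proj1 (filterlim_locally _ _) Hlim eps). apply filter_imp. intros N HN.
  unfold ball_norm. rewrite Esum.
  change (Cmod (CInt (rem 0%nat) - CInt (rem (S N)) - CInt (rem 0%nat))%C < eps).
  replace (CInt (rem 0%nat) - CInt (rem (S N)) - CInt (rem 0%nat))%C
    with (- CInt (rem (S N)))%C by ring.
  rewrite Cmod_opp. eapply Rle_lt_trans; [apply Hrem|].
  change (Rabs (2 * (W / e * p ^ S N) - 0) < eps) in HN. apply Rabs_def2 in HN. lra.
Qed.

(** A bound uniform in [t] supplies the radius of the expansion about [z]. Off the real axis it is
    the distance from [1] to the line through [0] and [z]; on the axis [1 - Re z * t] is affine in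
    [t], with its minimum at an endpoint. *)
Lemma slit_plane_dist (z : C) :
  ~ (Im z = 0 /\ 1 <= Re z) ->
  exists d, 0 < d /\ forall t, 0 <= t <= 1 -> d <= Cmod (1 - z * RtoC t)%C.
Proof.
  intros Hz. destruct (Req_dec (Im z) 0) as [H0|H0].
  - exists (Rmin 1 (1 - Re z)). split; [apply Rmin_glb_lt; lra|]. intros t Ht.
    eapply Rle_trans; [|apply re_le_Cmod]. eapply Rle_trans; [|apply Rle_abs].
    replace (Re (1 - z * RtoC t)) with (1 - Re z * t)
      by (destruct z; unfold Re, Im, RtoC, Cminus, Cmult, Cplus, Copp; simpl; ring).
    pose proof (Rmin_l 1 (1 - Re z)). pose proof (Rmin_r 1 (1 - Re z)).
    destruct (Rle_dec 0 (Re z)); nra.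
  - assert (Hm : 0 < Cmod z) by (apply Cmod_gt_0; intros ->; apply H0; reflexivity).
    exists (Rabs (Im z) / Cmod z). split.
    + apply Rdiv_lt_0_compat; [apply Rabs_pos_lt, H0|exact Hm].
    + intros t Ht. apply (Rmult_le_reg_r (Cmod z)); [exact Hm|].
      unfold Rdiv. rewrite Rmult_assoc, Rinv_l, Rmult_1_r by lra.
      (* [Im z] is minus the imaginary part of [(1 - z t) conj z] *)
      rewrite <- (Cmod_conj z), <- Cmod_mult.
      eapply Rle_trans; [|apply im_le_Cmod].
      replace (Im ((1 - z * RtoC t) * Cconj z)) with (- Im z)
        by (destruct z; unfold Cconj, Re, Im, RtoC, Cminus, Cmult, Cplus, Copp; simpl; ring).
      rewrite Rabs_Ropp. lra.
Qed.

Definition beta_weight (a b : nat) (t : R) : R := t ^ a * (1 - t) ^ b.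

(** [beta a b] is Euler's [B(a + 1, b + 1)]. *)
Definition beta (a b : nat) : R := RInt (beta_weight a b) 0 1.

Lemma continuous_beta_weight (a b : nat) (t : R) : continuous (beta_weight a b) t.
Proof.
  apply (ex_derive_continuous (beta_weight a b)). unfold beta_weight. auto_derive. trivial.
Qed.

Lemma ex_RInt_beta (a b : nat) : ex_RInt (beta_weight a b) 0 1.
Proof.
  apply (ex_RInt_continuous (V := R_CompleteNormedModule)). intros t _.
  apply continuous_beta_weight.
Qed.

Lemma beta_split (a b : nat) : beta a b = beta (S a) b + beta a (S b).
Proof.
  unfold beta. symmetry.
  etransitivity; [symmetry; apply (RInt_plus (V := R_CompleteNormedModule)); apply ex_RInt_beta|].
  apply RInt_ext. intros t _. unfold beta_weight, plus; simpl. ring.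
Qed.

(** The derivative of [t^(a+1) (1-t)^(b+1)] integrates to [0], since the function vanishes at both
    ends. *)
Lemma beta_parts (a b : nat) : INR (S a) * beta a (S b) = INR (S b) * beta (S a) b.
Proof.
  assert (H : is_RInt (fun t => INR (S a) * beta_weight a (S b) t - INR (S b) * beta_weight (S a) b t)
                0 1 0).
  { replace 0 with (minus (beta_weight (S a) (S b) 1) (beta_weight (S a) (S b) 0)) at 2
      by (unfold minus, plus, opp, beta_weight; cbn -[pow];
          rewrite Rminus_diag, !pow_i by lia; ring).
    apply (is_RInt_derive (beta_weight (S a) (S b))); intros t _.
    - unfold beta_weight. auto_derive; [trivial|].
      change (match a with 0%nat => 1 | S _ => INR a + 1 end) with (INR (S a)).
      change (match b with 0%nat => 1 | S _ => INR b + 1 end) with (INR (S b)).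
      unfold Rminus. simpl pow. ring.
    - apply (ex_derive_continuous (fun t => INR (S a) * beta_weight a (S b) t - INR (S b) * beta_weight (S a) b t)).
      unfold beta_weight. auto_derive. trivial. }
  assert (H' : is_RInt (fun t => INR (S a) * beta_weight a (S b) t - INR (S b) * beta_weight (S a) b t)
                0 1 (INR (S a) * beta a (S b) - INR (S b) * beta (S a) b)).
  { apply (is_RInt_minus (V := R_NormedModule));
      apply (is_RInt_scal (V := R_NormedModule)),
        (RInt_correct (V := R_CompleteNormedModule)), ex_RInt_beta. }
  pose proof (is_RInt_unique (V := R_CompleteNormedModule) _ _ _ _ H) as E.
  rewrite (is_RInt_unique (V := R_CompleteNormedModule) _ _ _ _ H') in E. lra.
Qed.

Lemma beta_S_l (a b : nat) :
  (INR (S a) + INR (S b)) * beta (S a) b = INR (S a) * beta a b.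
Proof. rewrite (beta_split a b). pose proof (beta_parts a b). lra. Qed.

Lemma beta_S_r (a b : nat) :
  (INR (S a) + INR (S b)) * beta a (S b) = INR (S b) * beta a b.
Proof. rewrite (beta_split a b). pose proof (beta_parts a b). lra. Qed.

Lemma beta_pos (a b : nat) : 0 < beta a b.
Proof.
  apply RInt_gt_0; [lra| |].
  - intros t Ht. apply Rmult_lt_0_compat; apply pow_lt; lra.
  - intros t _. apply continuous_beta_weight.
Qed.

Lemma pochhammer_1 (k : nat) : pochhammer 1 k = INR (fact k).
Proof.
  induction k as [|k IH]; [reflexivity|].
  cbn [pochhammer]. rewrite IH, INR_fact_S. ring.
Qed.

Lemma pochhammer_pos (a : R) (k : nat) : 0 < a -> 0 < pochhammer a k.
Proof.
  intros Ha. induction k as [|k IH]; cbn [pochhammer]; [lra|].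
  apply Rmult_lt_0_compat; [exact IH|]. pose proof (pos_INR k). lra.
Qed.

(** [pochhammer 1 k] cancels the factorial; the remaining quotient and [beta (a + k) b / beta a b]
    obey the same recurrence in [k]. The Gauss coefficients are thus normalized moments of the beta
    weight. *)
Lemma hyp2F1_coef_beta (a b k : nat) :
  hyp2F1_coef 1 (INR (S a)) (INR (S a) + INR (S b)) k = beta (a + k) b / beta a b.
Proof.
  pose proof (beta_pos a b) as Hb.
  assert (Hc : 0 < INR (S a) + INR (S b))
    by (rewrite !S_INR; pose proof (pos_INR a); pose proof (pos_INR b); lra).
  unfold hyp2F1_coef. rewrite pochhammer_1.
  pose proof (INR_fact_lt_0 k) as Hf.
  pose proof (pochhammer_pos _ k Hc) as Hp.
  transitivity (pochhammer (INR (S a)) k / pochhammer (INR (S a) + INR (S b)) k);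
    [field; lra|]. clear Hf.
  induction k as [|k IH].
  - rewrite Nat.add_0_r. simpl pochhammer. field. lra.
  - cbn [pochhammer] in Hp |- *.
    pose proof (pochhammer_pos _ k Hc) as Hk. specialize (IH Hk).
    pose proof (beta_S_l (a + k) b) as E.
    replace (a + S k)%nat with (S (a + k)) by lia.
    assert (Hd : 0 < INR (S a) + INR (S b) + INR k) by (pose proof (pos_INR k); lra).
    replace (INR (S (a + k))) with (INR (S a) + INR k) in E
      by (rewrite !S_INR, plus_INR; ring).
    assert (E' : beta (S (a + k)) b
      = (INR (S a) + INR k) * beta (a + k) b / (INR (S a) + INR (S b) + INR k))
      by (rewrite <- E; field; lra).
    rewrite E'.
    replace (_ / _) with (pochhammer (INR (S a)) k / pochhammer (INR (S a) + INR (S b)) k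
       * ((INR (S a) + INR k) / (INR (S a) + INR (S b) + INR k))) at 1 by (field; lra).
    rewrite IH. field. lra.
Qed.

Definition euler_integral (a b : nat) (z : C) : C :=
  CInt (fun t => RtoC (beta_weight a b t) / (1 - z * RtoC t) ^ 1)%C.

(** Both clauses are instances of [is_pseries_cauchy]: about [0] the coefficients are moments; about
    a point off the cut the radius comes from [slit_plane_dist]. *)
Lemma is_hyp2F1_euler_integral (a b : nat) :
  is_hyp2F1 1 (INR (S a)) (INR (S a) + INR (S b))
    (fun z => (RtoC (/ beta a b) * euler_integral a b z)%C).
Proof.
  pose proof (beta_pos a b) as Hb.
  split.
  - intros z Hz.
    assert (Hz' : Cmod (z - 0)%C < 1) by (replace (z - 0)%C with z by ring; exact Hz).
    assert (H : is_pseries (K := C_AbsRing) (V := C_NormedModule)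
      (fun k => CInt (fun t => RtoC (beta_weight a b t * t ^ k) / (1 - 0 * RtoC t) ^ S k)%C)
      (z - 0)%C (euler_integral a b z)).
    { apply (is_pseries_cauchy (beta_weight a b) 0 z 1); [apply continuous_beta_weight|lra| |exact Hz'].
      intros t _. replace (1 - 0 * RtoC t)%C with (RtoC 1) by ring. rewrite Cmod_1. lra. }
    replace (z - 0)%C with z in H by ring.
    generalize (is_pseries_scal (K := C_AbsRing) (V := C_NormedModule) (RtoC (/ beta a b)) _ z _
      (Cmult_comm _ _) H).
    apply is_pseries_ext. intros k.
    change ((RtoC (/ beta a b) * CInt (fun t => RtoC (beta_weight a b t * t ^ k) / (1 - 0 * RtoC t) ^ S k))%C
      = RtoC (hyp2F1_coef 1 (INR (S a)) (INR (S a) + INR (S b)) k)).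
    rewrite (CInt_ext _ (fun t => RtoC (beta_weight (a + k) b t))).
    + rewrite CInt_RtoC, <- RtoC_mult, hyp2F1_coef_beta. f_equal. unfold beta, Rdiv. ring.
    + intros t _. replace (1 - 0 * RtoC t)%C with (RtoC 1) by ring.
      rewrite Cpow_1_l. replace (beta_weight (a + k) b t) with (beta_weight a b t * t ^ k)
        by (unfold beta_weight; rewrite pow_add; ring).
      field.
  - intros z0 Hz0. destruct (slit_plane_dist z0 Hz0) as [d [Hd H]].
    exists (fun k => (RtoC (/ beta a b) * CInt (fun t => RtoC (beta_weight a b t * t ^ k) / (1 - z0 * RtoC t) ^ S k))%C), d.
    split; [exact Hd|]. intros z Hz.
    exact (is_pseries_scal (K := C_AbsRing) (V := C_NormedModule) (RtoC (/ beta a b)) _ _ _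
      (Cmult_comm _ _) (is_pseries_cauchy (beta_weight a b) z0 z d (continuous_beta_weight a b) Hd H Hz)).
Qed.

(** Integrate [z t / (1 - z t) = 1 / (1 - z t) - 1] against the weight. *)
Lemma euler_integral_S_l (a b : nat) (z : C) :
  ~ (Im z = 0 /\ 1 <= Re z) ->
  (z * euler_integral (S a) b z = euler_integral a b z - RtoC (beta a b))%C.
Proof.
  intros Hz. destruct (slit_plane_dist z Hz) as [d [Hd H]].
  pose proof (one_minus_neq_0 z d Hd H) as N.
  unfold euler_integral, beta.
  rewrite <- CInt_RtoC, <- CInt_scal, <- CInt_minus;
    try (apply C_cont_cauchy_kernel; [apply continuous_beta_weight|exact N]);
    [|apply C_cont_RtoC, continuous_beta_weight].
  apply CInt_ext. intros t Ht. specialize (N t Ht).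
  replace (beta_weight (S a) b t) with (t * beta_weight a b t)
    by (unfold beta_weight; simpl; ring).
  rewrite RtoC_mult. simpl Cpow. field. exact N.
Qed.

Lemma euler_integral_S_r (a b : nat) (z : C) :
  ~ (Im z = 0 /\ 1 <= Re z) ->
  (euler_integral a (S b) z = euler_integral a b z - euler_integral (S a) b z)%C.
Proof.
  intros Hz. destruct (slit_plane_dist z Hz) as [d [Hd H]].
  pose proof (one_minus_neq_0 z d Hd H) as N.
  unfold euler_integral.
  rewrite <- CInt_minus;
    try (apply C_cont_cauchy_kernel; [apply continuous_beta_weight|exact N]).
  apply CInt_ext. intros t Ht. specialize (N t Ht).
  replace (beta_weight (S a) b t) with (t * beta_weight a b t)
    by (unfold beta_weight; simpl; ring).
  replace (beta_weight a (S b) t) with ((1 - t) * beta_weight a b t)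
    by (unfold beta_weight; simpl; ring).
  rewrite !RtoC_mult, RtoC_minus. simpl Cpow. field. exact N.
Qed.

(** A branch of [- ln (1 - z)] on each open half plane. *)
Definition neg_log_one_minus (z : C) : C :=
  (- / 2 * ln ((1 - Re z) ^ 2 + Im z ^ 2),
   atan ((Re z ^ 2 + Im z ^ 2 - Re z) / Im z) + atan (Re z / Im z)).

(** The real and imaginary parts of [z / (1 - z t)] have the antiderivatives [- ln (Q t) / 2] and
    [atan ((m t - x) / y)], smooth in [t] because [y <> 0]; no branch has to be followed along the
    path. *)
Lemma euler_integral_0_0 (z : C) :
  Im z <> 0 -> (z * euler_integral 0 0 z = neg_log_one_minus z)%C.
Proof.
  intros Hy. destruct z as [x y]. unfold Im in Hy; simpl in Hy.
  assert (Hz : ~ (Im (x, y) = 0 /\ 1 <= Re (x, y))) by (intros [H _]; exact (Hy H)).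
  destruct (slit_plane_dist (x, y) Hz) as [d [Hd H]].
  pose proof (one_minus_neq_0 (x, y) d Hd H) as N.
  unfold euler_integral.
  rewrite <- CInt_scal by (apply C_cont_cauchy_kernel; [apply continuous_beta_weight|exact N]).
  set (m := x ^ 2 + y ^ 2).
  assert (Hm : 0 < m) by (unfold m; pose proof (pow2_ge_0 x); assert (0 < y ^ 2) by (apply pow2_gt_0, Hy); lra).
  (* [Q t] is [|1 - z t|^2]; completing the square shows that it is positive. *)
  set (Q := fun t => m * t ^ 2 - 2 * x * t + 1).
  assert (HQ : forall t, 0 < Q t).
  { intros t. unfold Q. apply (Rmult_lt_reg_l m); [exact Hm|].
    replace (m * (m * t ^ 2 - 2 * x * t + 1)) with ((m * t - x) ^ 2 + y ^ 2) by (unfold m; ring).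
    pose proof (pow2_ge_0 (m * t - x)). assert (0 < y ^ 2) by (apply pow2_gt_0, Hy). lra. }
  rewrite (CInt_ext _ (fun t => ((x - m * t) / Q t, y / Q t))).
  2:{ intros t Ht. specialize (N t Ht). specialize (HQ t).
      replace (((1 - (x, y) * RtoC t) ^ 1)%C) with (1 - x * t, - (y * t))
        by (apply injective_projections; simpl; ring).
      unfold beta_weight, Cdiv, Cinv, RtoC, Cmult; simpl.
      replace ((1 - x * t) * ((1 - x * t) * 1) + - (y * t) * (- (y * t) * 1)) with (Q t)
        by (unfold Q, m; ring).
      apply injective_projections; simpl; unfold m; field; lra. }
  unfold CInt, neg_log_one_minus. simpl Re; simpl Im.
  apply injective_projections; simpl fst; simpl snd.
  - apply (is_RInt_unique (V := R_CompleteNormedModule)).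
    replace (- / 2 * _) with (minus (- / 2 * ln (Q 1)) (- / 2 * ln (Q 0))).
    2:{ unfold minus, plus, opp; cbn -[pow].
        replace (Q 0) with 1 by (unfold Q; ring). rewrite ln_1.
        replace (Q 1) with ((1 - x) * ((1 - x) * 1) + y * (y * 1)) by (unfold Q, m; ring).
        unfold Re, Im. simpl. ring. }
    apply (is_RInt_derive (fun t => - / 2 * ln (Q t))); intros t _; specialize (HQ t); unfold Q in *.
    + auto_derive; [simpl in *; lra|]. field. simpl in *; lra.
    + apply (ex_derive_continuous (fun t => (x - m * t) / (m * t ^ 2 - 2 * x * t + 1))).
      auto_derive. simpl in *; lra.
  - apply (is_RInt_unique (V := R_CompleteNormedModule)).
    replace (atan _ + atan _) with (minus (atan ((m * 1 - x) / y)) (atan ((m * 0 - x) / y))).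
    2:{ unfold minus, plus, opp; cbn -[pow].
        replace ((m * 0 - x) / y) with (- (x / y)) by (field; exact Hy).
        rewrite atan_opp, Rmult_1_r. unfold m, Re, Im. simpl. ring. }
    apply (is_RInt_derive (fun t => atan ((m * t - x) / y))); intros t _; specialize (HQ t).
    + auto_derive; [trivial|]. unfold Q. field_simplify_eq.
      * unfold m. ring.
      * unfold Q in HQ.
        assert (E : y * y + (m * t + - x) * (m * t + - x) = m * (m * t ^ 2 - 2 * x * t + 1))
          by (unfold m; ring).
        rewrite E. repeat split; [lra|exact Hy|].
        apply Rgt_not_eq, Rmult_lt_0_compat; assumption.
    + apply (ex_derive_continuous (fun t => y / Q t)). unfold Q. auto_derive. unfold Q in HQ. simpl in *; lra.
Qed.

(** * Boundary values at [2] from either half plane *)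

Definition C_lim {T : Type} (F : (T -> Prop) -> Prop) (f : T -> C) (v : C) : Prop :=
  filterlim (fun z => Re (f z)) F (locally (Re v)) /\
  filterlim (fun z => Im (f z)) F (locally (Im v)).

Lemma filterlim_Rplus {T : Type} (F : (T -> Prop) -> Prop) {FF : Filter F}
  (f g : T -> R) (a b : R) :
  filterlim f F (locally a) -> filterlim g F (locally b) ->
  filterlim (fun z => f z + g z) F (locally (a + b)).
Proof.
  intros Hf Hg. exact (filterlim_comp_2 _ _ Rplus Hf Hg (filterlim_plus (V := R_NormedModule) a b)).
Qed.

Lemma filterlim_Rmult {T : Type} (F : (T -> Prop) -> Prop) {FF : Filter F}
  (f g : T -> R) (a b : R) :
  filterlim f F (locally a) -> filterlim g F (locally b) ->
  filterlim (fun z => f z * g z) F (locally (a * b)).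
Proof.
  intros Hf Hg. exact (filterlim_comp_2 _ _ Rmult Hf Hg (filterlim_mult (K := R_AbsRing) a b)).
Qed.

Lemma filterlim_Ropp {T : Type} (F : (T -> Prop) -> Prop) {FF : Filter F}
  (f : T -> R) (a : R) :
  filterlim f F (locally a) -> filterlim (fun z => - f z) F (locally (- a)).
Proof.
  intros Hf. exact (filterlim_comp _ _ _ _ _ _ _ _ Hf (filterlim_opp (V := R_NormedModule) a)).
Qed.

Lemma filterlim_Rinv {T : Type} (F : (T -> Prop) -> Prop) {FF : Filter F}
  (f : T -> R) (a : R) : a <> 0 ->
  filterlim f F (locally a) -> filterlim (fun z => / f z) F (locally (/ a)).
Proof.
  intros Ha Hf. exact (filterlim_comp _ _ _ _ _ _ _ _ Hf (continuous_Rinv a Ha)).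
Qed.

Lemma C_lim_const {T : Type} (F : (T -> Prop) -> Prop) {FF : Filter F} (c : C) :
  C_lim F (fun _ => c) c.
Proof. split; apply filterlim_const. Qed.

Lemma C_lim_minus {T : Type} (F : (T -> Prop) -> Prop) {FF : Filter F}
  (f g : T -> C) (u v : C) :
  C_lim F f u -> C_lim F g v -> C_lim F (fun z => (f z - g z)%C) (u - v)%C.
Proof.
  intros [H1 H2] [H3 H4].
  split; apply filterlim_Rplus; try assumption; apply filterlim_Ropp; assumption.
Qed.

Lemma C_lim_mult {T : Type} (F : (T -> Prop) -> Prop) {FF : Filter F}
  (f g : T -> C) (u v : C) :
  C_lim F f u -> C_lim F g v -> C_lim F (fun z => (f z * g z)%C) (u * v)%C.
Proof.
  intros [H1 H2] [H3 H4].
  split; apply filterlim_Rplus; try exact FF; try apply filterlim_Ropp; try exact FF;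
    apply filterlim_Rmult; assumption.
Qed.

Lemma C_lim_inv {T : Type} (F : (T -> Prop) -> Prop) {FF : Filter F} (f : T -> C) (u : C) :
  u <> 0 -> C_lim F f u -> C_lim F (fun z => (/ f z)%C) (/ u)%C.
Proof.
  intros Hu [H1 H2].
  assert (H : filterlim (fun z => / (Re (f z) ^ 2 + Im (f z) ^ 2)) F
                (locally (/ (Re u ^ 2 + Im u ^ 2)))).
  { apply filterlim_Rinv; [exact FF|apply Re_Im_sqr_neq_0, Hu|].
    apply filterlim_Rplus; [exact FF| |];
      (apply filterlim_Rmult; [exact FF|assumption|]);
      (apply filterlim_Rmult; [exact FF|assumption|apply filterlim_const]). }
  split; apply filterlim_Rmult; try assumption. apply filterlim_Ropp; assumption.
Qed.

Lemma C_lim_ext_loc {T : Type} (F : (T -> Prop) -> Prop) {FF : Filter F} (f g : T -> C) (u : C) :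
  F (fun z => f z = g z) -> C_lim F f u -> C_lim F g u.
Proof.
  intros H [H1 H2].
  split; [revert H1|revert H2]; apply filterlim_ext_loc; revert H; apply filter_imp;
    intros z ->; reflexivity.
Qed.

Lemma C_lim_filterlim {T : Type} (F : (T -> Prop) -> Prop) {FF : Filter F} (f : T -> C) (u : C) :
  C_lim F f u -> filterlim f F (locally u).
Proof.
  intros [H1 H2]. apply filterlim_locally. intros eps.
  generalize (filter_and _ _ (proj1 (filterlim_locally _ _) H1 eps)
                (proj1 (filterlim_locally _ _) H2 eps)).
  apply filter_imp. intros z [A B]. split; assumption.
Qed.

Definition half_nbhd (upper : bool) : (C -> Prop) -> Prop :=
  within (half_plane upper) (locally (RtoC 2)).

(** Properness makes the limit on the cut unique; the witnesses are points straight above or below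
    [2]. *)
Lemma half_nbhd_proper (upper : bool) : ProperFilter (half_nbhd upper).
Proof.
  constructor; [|apply within_filter, locally_filter].
  intros P [eps HP]. destruct eps as [e He].
  assert (B : forall y, Rabs y < e -> ball (RtoC 2) (mkposreal e He) (2, y)).
  { intros y Hy. split; [apply ball_center|].
    change (Rabs (y - 0) < e). rewrite Rminus_0_r. exact Hy. }
  destruct upper.
  - exists (2, e / 2). apply HP; [apply B; rewrite Rabs_pos_eq; lra|].
    unfold half_plane, Im; simpl. lra.
  - exists (2, - (e / 2)). apply HP; [apply B; rewrite Rabs_Ropp, Rabs_pos_eq; lra|].
    unfold half_plane, Im; simpl. lra.
Qed.

#[local] Existing Instance half_nbhd_proper.

Lemma half_nbhd_half_plane (upper : bool) : half_nbhd upper (half_plane upper).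
Proof. exists (mkposreal 1 Rlt_0_1). auto. Qed.

Lemma half_plane_Im (upper : bool) (z : C) : half_plane upper z -> Im z <> 0.
Proof. destruct upper; simpl; lra. Qed.

Lemma C_lim_id (upper : bool) : C_lim (half_nbhd upper) (fun z => z) (RtoC 2).
Proof.
  split; (eapply filterlim_filter_le_1; [apply filter_le_within|]);
    intros P [eps HP]; exists eps; intros z [Hz1 Hz2]; apply HP; assumption.
Qed.

Definition half_sign (upper : bool) : R := if upper then 1 else -1.

(** The quotient diverges with the sign of [Im z]. The reflection of [atan u] into [atan (1 / u)]
    trades it for [Im z / f z], which tends to [0]. *)
Lemma atan_div_Im_lim (upper : bool) (f : C -> R) (v : R) :
  0 < v -> filterlim f (half_nbhd upper) (locally v) ->
  filterlim (fun z => atan (f z / Im z)) (half_nbhd upper)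
    (locally (half_sign upper * (PI / 2))).
Proof.
  intros Hv Hf.
  apply (filterlim_ext_loc (fun z => half_sign upper * (PI / 2) + - atan (Im z * / f z))).
  - assert (Hp : half_nbhd upper (fun z => 0 < f z)) by (apply (Hf (fun u => 0 < u)), (open_gt 0), Hv).
    generalize (filter_and _ _ Hp (half_nbhd_half_plane upper)).
    apply filter_imp. intros z [Hfz Hz]. destruct upper; simpl in *.
    + replace (f z / Im z) with (/ (Im z * / f z)) by (field; lra).
      rewrite atan_inv; [ring|]. apply Rmult_lt_0_compat; [|apply Rinv_0_lt_compat]; lra.
    + replace (f z / Im z) with (- / (- Im z * / f z)) by (field; lra).
      rewrite atan_opp, atan_inv.
      * rewrite Ropp_mult_distr_l_reverse, atan_opp. ring.
      * apply Rmult_lt_0_compat; [|apply Rinv_0_lt_compat]; lra.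
  - replace (locally (half_sign upper * (PI / 2)))
      with (locally (half_sign upper * (PI / 2) + - atan (0 * / v)))
      by (f_equal; rewrite Rmult_0_l, atan_0; ring).
    apply filterlim_Rplus; [exact _|apply filterlim_const|].
    apply filterlim_Ropp; [exact _|].
    eapply filterlim_comp; [|apply continuous_atan].
    apply filterlim_Rmult; [exact _|apply (proj2 (C_lim_id upper))|].
    apply filterlim_Rinv; [exact _|lra|exact Hf].
Qed.

(** At [2] the modulus of [1 - z] is [1], so the logarithm vanishes. The limiting numerators
    [2^2 - 2] and [2] are positive, so both arctangents have the same limit: the side enters only
    the imaginary part. *)
Lemma neg_log_one_minus_lim (upper : bool) :
  C_lim (half_nbhd upper) neg_log_one_minus (0, half_sign upper * PI).
Proof.
  destruct (C_lim_id upper) as [Hx Hy].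
  change (filterlim Re (half_nbhd upper) (locally 2)) in Hx.
  change (filterlim Im (half_nbhd upper) (locally 0)) in Hy.
  assert (Hsq : forall f a, filterlim f (half_nbhd upper) (locally a) ->
            filterlim (fun z => f z ^ 2) (half_nbhd upper) (locally (a ^ 2))).
  { intros f a Hf. apply filterlim_Rmult; [exact _|exact Hf|].
    apply filterlim_Rmult; [exact _|exact Hf|apply filterlim_const]. }
  split; unfold neg_log_one_minus.
  - change (filterlim (fun z => - / 2 * ln ((1 - Re z) ^ 2 + Im z ^ 2)) (half_nbhd upper) (locally 0)).
    replace (locally 0) with (locally (- / 2 * ln ((1 + - 2) ^ 2 + 0 ^ 2)))
      by (f_equal; replace ((1 + - 2) ^ 2 + 0 ^ 2) with 1 by ring; rewrite ln_1; ring).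
    apply filterlim_Rmult; [exact _|apply filterlim_const|].
    apply (filterlim_comp _ _ _ (fun z => (1 - Re z) ^ 2 + Im z ^ 2) ln _ (locally ((1 + - 2) ^ 2 + 0 ^ 2)));
      [|apply continuous_ln; lra].
    apply filterlim_Rplus; [exact _| |apply Hsq, Hy].
    apply Hsq. apply filterlim_Rplus; [exact _|apply filterlim_const|].
    apply filterlim_Ropp; [exact _|exact Hx].
  - change (filterlim (fun z => atan ((Re z ^ 2 + Im z ^ 2 - Re z) / Im z) + atan (Re z / Im z))
              (half_nbhd upper) (locally (half_sign upper * PI))).
    replace (locally (half_sign upper * PI))
      with (locally (half_sign upper * (PI / 2) + half_sign upper * (PI / 2)))
      by (f_equal; field).
    apply filterlim_Rplus; [exact _| |apply (atan_div_Im_lim upper Re 2); [lra|exact Hx]].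
    apply (atan_div_Im_lim upper _ (2 ^ 2 + 0 ^ 2 + - 2)); [lra|].
    apply filterlim_Rplus; [exact _| |apply filterlim_Ropp; [exact _|exact Hx]].
    apply filterlim_Rplus; [exact _|apply Hsq, Hx|apply Hsq, Hy].
Qed.

(** The principal value of [\int_0^1 t^a (1 - t)^b / (1 - 2 t) dt]. *)
Fixpoint pv_beta_0 (a : nat) : R :=
  match a with
  | O => 0
  | S a' => (pv_beta_0 a' - beta a' 0) / 2
  end.

Fixpoint pv_beta (a b : nat) : R :=
  match b with
  | O => pv_beta_0 a
  | S b' => pv_beta a b' - pv_beta (S a) b'
  end.

(** Built into the definition for [b = 0]; [beta_split] carries it to larger [b]. *)
Lemma pv_beta_S_l (a b : nat) : 2 * pv_beta (S a) b = pv_beta a b - beta a b.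
Proof.
  revert a. induction b as [|b IH]; intros a.
  - simpl. field.
  - cbn [pv_beta]. pose proof (IH a). pose proof (IH (S a)). pose proof (beta_split a b). lra.
Qed.

Lemma pv_beta_S_r (a b : nat) : 2 * pv_beta a (S b) = pv_beta a b + beta a b.
Proof. cbn [pv_beta]. pose proof (pv_beta_S_l a b). lra. Qed.

(** The integrand of the principal value is odd under [t -> 1 - t]. The proof goes through the
    relations: [beta a (S a)] is half of [beta a a], hence equal to [pv_beta a (S a)]. *)
Lemma pv_beta_diag (a : nat) : pv_beta a a = 0.
Proof.
  induction a as [|a IH]; [reflexivity|].
  pose proof (pv_beta_S_l a (S a)). pose proof (pv_beta_S_r a a).
  pose proof (beta_parts a a). pose proof (beta_split a a).
  assert (0 < INR (S a)) by (apply lt_0_INR; lia).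
  assert (beta a (S a) = beta (S a) a) by (apply (Rmult_eq_reg_l (INR (S a))); lra).
  lra.
Qed.

Lemma half_plane_slit (upper : bool) (z : C) :
  half_plane upper z -> ~ (Im z = 0 /\ 1 <= Re z).
Proof. intros H [E _]. exact (half_plane_Im upper z H E). Qed.

Lemma RtoC_neq_0 (x : R) : x <> 0 -> RtoC x <> 0.
Proof. intros H E. apply H. exact (f_equal Re E). Qed.

Lemma euler_integral_div_lim (upper : bool) (f g : C -> C) (u v : R) :
  (forall z, half_plane upper z -> (z * f z = g z)%C) ->
  C_lim (half_nbhd upper) g (u, v) -> C_lim (half_nbhd upper) f (u / 2, v / 2).
Proof.
  intros H Hg.
  replace ((u / 2, v / 2) : C) with ((u, v) * / RtoC 2)%C.
  - apply (C_lim_ext_loc _ (fun z => (g z * / z)%C)).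
    + generalize (half_nbhd_half_plane upper). apply filter_imp. intros z Hz.
      rewrite <- (H z Hz). assert (z <> 0).
      { intros E. apply (half_plane_Im upper z Hz). rewrite E. reflexivity. }
      field. assumption.
    + apply C_lim_mult; [exact _|exact Hg|].
      apply C_lim_inv; [exact _|apply RtoC_neq_0; lra|apply C_lim_id].
  - apply injective_projections; simpl; field.
Qed.

(** At [2] every relation has real coefficients, so the real parts obey the recursion of [pv_beta]
    on either side. The imaginary part is kept existential: the theorem concerns real parts
    alone. *)
Lemma euler_integral_lim (upper : bool) (a b : nat) :
  exists v, C_lim (half_nbhd upper) (euler_integral a b) (pv_beta a b, v).
Proof.
  revert a. induction b as [|b IH]; intros a.
  - induction a as [|a [v IHa]].
    + exists (half_sign upper * PI / 2). simpl pv_beta.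
      replace 0 with (0 / 2) by field.
      apply (euler_integral_div_lim upper _ neg_log_one_minus); [|apply neg_log_one_minus_lim].
      intros z Hz. apply euler_integral_0_0, (half_plane_Im upper), Hz.
    + exists ((v + - 0) / 2).
      apply (euler_integral_div_lim upper _ (fun z => euler_integral a 0 z - RtoC (beta a 0))%C).
      * intros z Hz. apply euler_integral_S_l, (half_plane_slit upper), Hz.
      * exact (C_lim_minus _ _ _ _ _ IHa (C_lim_const _ (RtoC (beta a 0)))).
  - destruct (IH a) as [v Hv]. destruct (IH (S a)) as [w Hw].
    exists (v + - w).
    apply (C_lim_ext_loc _ (fun z => euler_integral a b z - euler_integral (S a) b z)%C).
    + generalize (half_nbhd_half_plane upper). apply filter_imp. intros z Hz.
      symmetry. apply euler_integral_S_r, (half_plane_slit upper), Hz.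
    + exact (C_lim_minus _ _ _ _ _ Hv Hw).
Qed.

Lemma Re_hyp2F1_cut (upper : bool) (a b : nat) :
  Re (hyp2F1_cut upper 1 (INR (S a)) (INR (S a) + INR (S b)) 2) = pv_beta a b / beta a b.
Proof.
  destruct (euler_integral_lim upper a b) as [v Hv].
  pose proof (C_lim_mult _ _ _ _ _ (C_lim_const _ (RtoC (/ beta a b))) Hv) as Hlim.
  apply C_lim_filterlim in Hlim; [|exact _].
  unfold hyp2F1_cut.
  rewrite (iota_unique (V := C_CompleteNormedModule) _ (RtoC (/ beta a b) * (pv_beta a b, v))%C).
  - simpl. unfold Rdiv. ring.
  (* Uniqueness for [iota]: another continuation [F] agrees with the Euler integral on the open half
     plane, so its limit is the same. *)
  - intros y [F [HF Hy]].
    apply (filterlim_locally_unique (K := C_AbsRing) (V := C_NormedModule) (F := half_nbhd upper) F).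
    + exact Hy.
    + revert Hlim. apply filterlim_ext_loc.
      generalize (half_nbhd_half_plane upper). apply filter_imp. intros z Hz.
      exact (is_hyp2F1_unique _ _ _ _ _ (is_hyp2F1_euler_integral a b) HF z
               (half_plane_Im upper z Hz)).
  - eexists. split; [apply is_hyp2F1_euler_integral|exact Hlim].
Qed.

(** * The coefficients at [z = 2] and Laguerre sums *)

(** [f 0 + ... + f (m - 1)], shifted to match the index [l = j + 1] of the theorem. *)
Definition psum (f : nat -> R) (m : nat) : R := sum_n_m (fun l => f (l - 1)%nat) 1 m.

Lemma psum_0 (f : nat -> R) : psum f 0 = 0.
Proof. unfold psum. rewrite sum_n_m_zero by lia. reflexivity. Qed.

Lemma psum_S (f : nat -> R) (m : nat) : psum f (S m) = psum f m + f m.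
Proof.
  unfold psum. rewrite sum_n_Sm by lia. rewrite Nat.sub_succ, Nat.sub_0_r. reflexivity.
Qed.

(** [cut_coef j m] is the real part of [2F1(1, j + 1; j + m + 2; 2)]. *)
Definition cut_coef (j m : nat) : R := pv_beta j m / beta j m.

Lemma cut_coef_S_l (j m : nat) :
  2 * INR (S j) * cut_coef (S j) m = (INR (S j) + INR (S m)) * (cut_coef j m - 1).
Proof.
  unfold cut_coef. pose proof (pv_beta_S_l j m) as E. pose proof (beta_S_l j m) as Eb.
  pose proof (beta_pos j m). pose proof (beta_pos (S j) m).
  assert (0 < INR (S j)) by (apply lt_0_INR; lia).
  replace (2 * INR (S j) * (pv_beta (S j) m / beta (S j) m))
    with (INR (S j) * (2 * pv_beta (S j) m) / beta (S j) m) by (field; lra).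
  rewrite E. apply (Rmult_eq_reg_r (beta (S j) m * beta j m)); [|nra].
  transitivity (INR (S j) * beta j m * (pv_beta j m - beta j m)); [field; lra|].
  rewrite <- Eb. field. lra.
Qed.

Lemma cut_coef_S_r (j m : nat) :
  2 * INR (S m) * cut_coef j (S m) = (INR (S j) + INR (S m)) * (cut_coef j m + 1).
Proof.
  unfold cut_coef. pose proof (pv_beta_S_r j m) as E. pose proof (beta_S_r j m) as Eb.
  pose proof (beta_pos j m). pose proof (beta_pos j (S m)).
  assert (0 < INR (S m)) by (apply lt_0_INR; lia).
  replace (2 * INR (S m) * (pv_beta j (S m) / beta j (S m)))
    with (INR (S m) * (2 * pv_beta j (S m)) / beta j (S m)) by (field; lra).
  rewrite E. apply (Rmult_eq_reg_r (beta j (S m) * beta j m)); [|nra].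
  transitivity (INR (S m) * beta j m * (pv_beta j m + beta j m)); [field; lra|].
  rewrite <- Eb. field. lra.
Qed.

Lemma cut_coef_diag (m : nat) : cut_coef m m = 0.
Proof. unfold cut_coef, Rdiv. rewrite pv_beta_diag. ring. Qed.

(** Write [c_j] for [cut_coef j m]. By [cut_coef_S_l], [(m + 2 - j) c_j = 2 (j + 1) c_(j+1) - 2 j
    c_j + (j + m + 2)], so the sum telescopes; the end term is expressed through [c_M] again. *)
Lemma psum_cut_coef_weighted (m M : nat) :
  psum (fun j => (INR m + 2 - INR j) * cut_coef j m) (S M)
    = INR M * INR (S m) + INR M * (INR M + 1) / 2
      + (INR (S m) + INR (S M)) * cut_coef M m.
Proof.
  induction M as [|M IH].
  - rewrite psum_S, psum_0. rewrite !S_INR. simpl INR. field.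
  - rewrite psum_S, IH. pose proof (cut_coef_S_l M m) as E.
    rewrite !S_INR in *. nra.
Qed.

(** The factor [j + m + 2] of [cut_coef_S_r] is split as [(2 m + 4) - (m + 2 - j)], to bring in the
    weighted sum. *)
Lemma psum_cut_coef_S_r (m M : nat) :
  2 * INR (S m) * psum (fun j => cut_coef j (S m)) M
    = (2 * INR (S m) + 2) * psum (fun j => cut_coef j m) M
      - psum (fun j => (INR m + 2 - INR j) * cut_coef j m) M
      + (INR M * INR (S m) + INR M * (INR M + 1) / 2).
Proof.
  induction M as [|M IH].
  - rewrite !psum_0. simpl INR. field.
  - rewrite !psum_S, Rmult_plus_distr_l, IH, cut_coef_S_r, !S_INR. field.
Qed.

(** Divided by [m + 1], the sum grows by [1 / (m + 2)] when [m] becomes [m + 1]: the harmonic number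
    originates here. *)
Lemma psum_cut_coef (m : nat) :
  psum (fun j => cut_coef j m) m = INR (S m) * harmonic (S m) - INR (S m).
Proof.
  (* The vanishing diagonal term extends the range by one, as the passage from [m] to [S m]
     requires. *)
  assert (H : forall m, psum (fun j => cut_coef j m) (S m) = psum (fun j => cut_coef j m) m)
    by (intros k; rewrite psum_S, cut_coef_diag; ring).
  induction m as [|m IH].
  - rewrite psum_0, harmonic_S, harmonic_0. simpl. field.
  - pose proof (psum_cut_coef_S_r m (S m)) as E.
    rewrite psum_cut_coef_weighted, cut_coef_diag, H, IH in E.
    assert (Hp : 0 < INR (S m)) by (apply lt_0_INR; lia).
    apply (Rmult_eq_reg_l (2 * INR (S m))); [|lra].
    rewrite E, (harmonic_S (S m)), !S_INR. rewrite !S_INR in Hp. field. lra.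
Qed.

Lemma psum_inv_reverse (m k : nat) :
  (k <= m)%nat -> psum (fun j => / (INR m - INR j)) k = harmonic m - harmonic (m - k).
Proof.
  induction k as [|k IH]; intros Hk.
  - rewrite psum_0, Nat.sub_0_r. ring.
  - rewrite psum_S, IH by lia. replace (m - k)%nat with (S (m - S k)) by lia.
    rewrite harmonic_S. replace (S (m - S k)) with (m - k)%nat by lia.
    rewrite minus_INR by lia. ring.
Qed.

Lemma psum_ratio (m k : nat) :
  (k <= m)%nat ->
  psum (fun j => (INR (S m) + INR (S j)) / (INR (S m) - INR (S j))) k
    = 2 * INR (S m) * psum (fun j => / (INR m - INR j)) k - INR k.
Proof.
  induction k as [|k IH]; intros Hk.
  - rewrite !psum_0. simpl. ring.
  - rewrite !psum_S, IH by lia. rewrite !S_INR.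
    assert (INR (S k) <= INR m) by (apply le_INR; lia). rewrite S_INR in H.
    field. lra.
Qed.

Lemma psum_lag_0 (m k : nat) :
  (k <= m)%nat ->
  psum (fun j => ((INR (S m) + INR (S j)) / (INR (S m) - INR (S j)) - cut_coef j m)
                 * (lag j 0 / INR (S j))) k
  = psum (fun j => (INR (S m) + INR (S j)) / (INR (S m) - INR (S j))) k
    - psum (fun j => cut_coef j m) k.
Proof.
  induction k as [|k IH]; intros Hk.
  - rewrite !psum_0. ring.
  - rewrite !psum_S, IH, lag_0 by lia.
    assert (INR (S k) <> 0) by (apply not_0_INR; lia).
    assert (INR (S k) < INR (S m)) by (apply lt_INR; lia).
    field. split; lra.
Qed.

Lemma lag_0_l (x : R) : lag 0 x = 1.
Proof.
  rewrite <- laguerre_lag. unfold laguerre. rewrite sum_O.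
  pose proof (Gamma_INR 1) as E. simpl INR in E. simpl.
  replace (0 + 1 + 1) with (1 + 1) by ring. rewrite E. field.
Qed.

Lemma dlag_0_l (x : R) : dlag 0 x = 0.
Proof.
  pose proof (is_derive_lag 0 x) as H. apply is_derive_unique in H. rewrite <- H.
  rewrite (Derive_ext _ (fun _ => 1)) by apply lag_0_l. apply Derive_const.
Qed.

Lemma dlag_psum (m : nat) (x : R) : dlag m x = - psum (fun j => lag j x) m.
Proof.
  induction m as [|m IH].
  - rewrite dlag_0_l, psum_0. ring.
  - rewrite dlag_S, IH, psum_S. ring.
Qed.

(** The derivatives are eliminated between [dlag_S_lag] at [m] and at [S m]. *)
Lemma lag_three_term (m : nat) (x : R) :
  x * lag (S m) x = INR (S (S m)) * (2 * lag (S m) x - lag m x - lag (S (S m)) x).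
Proof.
  pose proof (dlag_S_lag m x) as E1. pose proof (dlag_S_lag (S m) x) as E2.
  rewrite dlag_S in E2. rewrite !S_INR in *. lra.
Qed.

(** Divided by the index, the three term relation makes [x L_j / (j + 1)] a second difference of the
    [L_j], which telescopes. *)
Lemma psum_lag_div (m : nat) (x : R) :
  x * psum (fun j => lag j x / INR (S j)) (S m) = 1 - lag (S m) x + lag m x.
Proof.
  induction m as [|m IH].
  - rewrite psum_S, psum_0, lag_0_l.
    pose proof (dlag_S_lag 0 x) as E. rewrite dlag_S, dlag_0_l, lag_0_l in E.
    simpl INR in *. lra.
  - rewrite psum_S, Rmult_plus_distr_l, IH.
    replace (x * (lag (S m) x / INR (S (S m)))) with (x * lag (S m) x / INR (S (S m)))
      by (field; apply not_0_INR; lia).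
    rewrite lag_three_term. field. apply not_0_INR; lia.
Qed.

Lemma psum_lag_reverse (m M : nat) (x : R) :
  psum (fun j => (INR (S m) - INR j) / INR (S j) * lag j x) M
    = psum (fun j => (INR m - INR j) / INR (S j) * lag j x) M
      + psum (fun j => lag j x / INR (S j)) M.
Proof.
  induction M as [|M IH]; [rewrite !psum_0; ring|].
  rewrite !psum_S, IH, (S_INR m). field. apply not_0_INR; lia.
Qed.

(** Raising [m] by one adds [1 / (j + 1)] to each weight, which [psum_lag_div] sums; the old weight
    at [j = m] is zero, so the range may grow along with [m]. *)
Lemma lag_expansion (m : nat) (x : R) :
  x * psum (fun j => (INR m - INR j) / INR (S j) * lag j x) m = INR (S m) - lag m x.
Proof.
  induction m as [|m IH].
  - rewrite psum_0, lag_0_l. simpl. ring.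
  - rewrite psum_lag_reverse, Rmult_plus_distr_l, psum_lag_div, psum_S.
    replace ((INR m - INR m) / INR (S m) * lag m x) with 0
      by (unfold Rdiv; ring).
    rewrite Rplus_0_r, IH, (S_INR (S m)). ring.
Qed.

(** The numerator is [(m - j) + 2 (j + 1)]; the first part is summed by [lag_expansion], the second
    by [dlag_psum]. *)
Lemma psum_lag_shift (m M : nat) (x : R) :
  psum (fun j => (INR (S m) + INR (S j)) / INR (S j) * lag j x) M
    = psum (fun j => (INR m - INR j) / INR (S j) * lag j x) M
      + 2 * psum (fun j => lag j x) M.
Proof.
  induction M as [|M IH]; [rewrite !psum_0; ring|].
  rewrite !psum_S, IH, !S_INR. field. rewrite <- S_INR. apply not_0_INR; lia.
Qed.

Lemma psum_lag_eq (m : nat) (x : R) :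
  x * psum (fun j => (INR (S m) + INR (S j)) / INR (S j) * lag j x) m
    = INR (S m) - lag m x - 2 * x * dlag m x.
Proof.
  rewrite psum_lag_shift, Rmult_plus_distr_l, lag_expansion, dlag_psum. ring.
Qed.

(** Replacing [x * dlag j x] by [dlag_S_lag] leaves [lag j] with the coefficient
    [(m + 2 + j) c_j / (j + 1) - 2 c_(j+1)], where [c_j] is [cut_coef j m]; by [cut_coef_S_l] it
    equals [(m + 2 + j) / (j + 1)]. The boundary term carries [c_m = 0]. *)
Lemma psum_cut_coef_lag (m : nat) (x : R) :
  psum (fun j => cut_coef j m / INR (S j)
          * (2 * x * dlag j x + (INR m + 2 - INR j) * lag j x)) m
    = psum (fun j => (INR (S m) + INR (S j)) / INR (S j) * lag j x) m.
Proof.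
  assert (H : forall M, psum (fun j => cut_coef j m / INR (S j)
          * (2 * x * dlag j x + (INR m + 2 - INR j) * lag j x)) (S M)
    = psum (fun j => (INR (S m) + INR (S j)) / INR (S j) * lag j x) (S M)
      + 2 * cut_coef (S M) m * lag M x).
  { induction M as [|M IH].
    - rewrite !psum_S, !psum_0, dlag_0_l, lag_0_l.
      pose proof (cut_coef_S_l 0 m) as E. rewrite !S_INR in *. simpl INR in *.
      replace (2 * cut_coef 1 m * 1) with (2 * (0 + 1) * cut_coef 1 m) by ring.
      rewrite E. field.
    - rewrite psum_S, IH, (psum_S _ (S M)).
      pose proof (dlag_S_lag M x) as E1.
      replace (2 * x * dlag (S M) x) with (2 * (x * dlag (S M) x)) by ring. rewrite E1.
      assert (Hp : INR (S (S M)) <> 0) by (apply not_0_INR; lia).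
      apply (Rmult_eq_reg_l (INR (S (S M)))); [|exact Hp].
      rewrite !(Rmult_plus_distr_l (INR (S (S M)))).
      replace (INR (S (S M)) * (2 * cut_coef (S (S M)) m * lag (S M) x))
        with (2 * INR (S (S M)) * cut_coef (S (S M)) m * lag (S M) x) by ring.
      rewrite (cut_coef_S_l (S M) m).
      rewrite !S_INR in *. field. lra. }
  destruct m as [|m]; [rewrite !psum_0; reflexivity|].
  rewrite H, cut_coef_diag. ring.
Qed.

(** * The Kummer operator *)

Definition entire (f : R -> R) : Prop :=
  exists a : nat -> R, forall x, is_pseries a x (f x).

Lemma entire_ext (f g : R -> R) : (forall x, f x = g x) -> entire f -> entire g.
Proof. intros H [a Ha]. exists a. intros x. rewrite <- H. apply Ha. Qed.

Lemma entire_lincomb (p q : R) (f g : R -> R) :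
  entire f -> entire g -> entire (fun x => p * f x + q * g x).
Proof.
  intros [a Ha] [b Hb]. eexists. intros x. apply is_pseries_lincomb2; [apply Ha|apply Hb].
Qed.

Lemma entire_mult (f g : R -> R) :
  entire f -> entire g -> entire (fun x => f x * g x).
Proof.
  intros [a Ha] [b Hb]. exists (PS_mult a b). intros x.
  assert (Ra : CV_radius a = p_infty) by (apply CV_radius_p_infty; intros y; eexists; apply Ha).
  assert (Rb : CV_radius b = p_infty) by (apply CV_radius_p_infty; intros y; eexists; apply Hb).
  apply is_pseries_mult; [apply Ha|apply Hb|rewrite Ra; exact I|rewrite Rb; exact I].
Qed.

Lemma entire_const (c : R) : entire (fun _ => c).
Proof.
  exists (fun k => match k with O => c | S _ => 0 end). intros x.
  apply PSeries.is_pseries_R.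
  apply (filterlim_ext (fun _ => c)); [|apply filterlim_const].
  intros N. induction N as [|N IH].
  - rewrite sum_O. simpl. eqR. ring.
  - rewrite sum_Sn, <- IH. unfold plus; simpl. eqR. ring.
Qed.

Lemma entire_psum (f : nat -> R -> R) (m : nat) :
  (forall j, entire (f j)) -> entire (fun x => psum (fun j => f j x) m).
Proof.
  intros H. induction m as [|m IH].
  - apply (entire_ext (fun _ => 0)); [intros x; symmetry; apply psum_0|apply entire_const].
  - apply (entire_ext (fun x => 1 * psum (fun j => f j x) m + 1 * f m x));
      [intros x; rewrite psum_S; ring|apply entire_lincomb; [exact IH|apply H]].
Qed.

(** The Kummer equation [x f'' + (2 - x) f' + m f = g], required only for
    [x < 0]: for entire [f] and [g = 0] this half line already determines all
    power series coefficients. *)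
Definition kummer_op (m : R) (f g : R -> R) : Prop :=
  exists f1 f2 : R -> R, forall x, x < 0 ->
    is_derive f x (f1 x) /\ is_derive f1 x (f2 x) /\
    x * f2 x + (2 - x) * f1 x + m * f x = g x.

(** The coefficient of [x ^ k] in the image: [x f''] and [2 f'] contribute [k (k + 1)] and
    [2 (k + 1)] times [a (S k)]. *)
Definition kummer_op_coef (m : R) (a : nat -> R) (k : nat) : R :=
  INR (S k) * INR (S (S k)) * a (S k) + (m - INR k) * a k.

Lemma is_pseries_kummer_op (m : R) (a : nat -> R) (x : R) :
  (forall y, ex_pseries a y) ->
  is_pseries (kummer_op_coef m a) x
    (x * PSeries (PS_derive (PS_derive a)) x + (2 - x) * PSeries (PS_derive a) x
     + m * PSeries a x).
Proof.
  intros H.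
  assert (H1 : forall y, is_pseries (PS_derive a) y (PSeries (PS_derive a) y))
    by (intros y; apply is_pseries_derive_PSeries, H).
  assert (H2 : is_pseries (PS_derive (PS_derive a)) x (PSeries (PS_derive (PS_derive a)) x))
    by (apply is_pseries_derive_PSeries; intros y; eexists; apply H1).
  pose proof (is_pseries_incr_1 _ _ _ H2) as H3.
  pose proof (is_pseries_incr_1 _ _ _ (H1 x)) as H4.
  pose proof (is_pseries_lincomb2 _ _ 1 2 _ _ _ H3 (H1 x)) as H5.
  pose proof (is_pseries_lincomb2 _ _ (-1) m _ _ _ H4 (PSeries_correct _ _ (H x))) as H6.
  pose proof (is_pseries_lincomb2 _ _ 1 1 _ _ _ H5 H6) as H7.
  unfold scal in H7; simpl in H7; unfold mult in H7; simpl in H7.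
  replace (_ + _ + _) with
    (1 * (1 * (x * PSeries (PS_derive (PS_derive a)) x) + 2 * PSeries (PS_derive a) x) +
     1 * (-1 * (x * PSeries (PS_derive a) x) + m * PSeries a x)) by ring.
  revert H7. apply is_pseries_ext. intros [|k]; cbv beta; unfold PS_incr_1, PS_derive, kummer_op_coef.
  - change (@zero R_NormedModule) with 0. simpl INR. eqR. ring.
  - rewrite !S_INR. eqR. ring.
Qed.

Lemma kummer_op_pseries (m : R) (a : nat -> R) (f g : R -> R) :
  (forall x, is_pseries a x (f x)) ->
  (forall x, is_pseries (kummer_op_coef m a) x (g x)) -> kummer_op m f g.
Proof.
  intros Ha Hg. assert (H : forall y, ex_pseries a y) by (intros y; eexists; apply Ha).
  assert (H1 : forall y, ex_pseries (PS_derive a) y)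
    by (intros y; eexists; apply is_pseries_derive_PSeries, H).
  exists (PSeries (PS_derive a)), (PSeries (PS_derive (PS_derive a))).
  intros x _. split; [|split].
  - apply (is_derive_ext (PSeries a)); [intros t; apply is_pseries_unique, Ha|].
    apply is_pseries_derive_PSeries, H.
  - apply is_pseries_derive_PSeries, H1.
  - rewrite <- (is_pseries_unique _ _ _ (Hg x)), <- (is_pseries_unique _ _ _ (Ha x)).
    symmetry. apply is_pseries_unique, is_pseries_kummer_op, H.
Qed.

Lemma kummer_op_lincomb (m p q : R) (f g u v : R -> R) :
  kummer_op m f u -> kummer_op m g v ->
  kummer_op m (fun x => p * f x + q * g x) (fun x => p * u x + q * v x).
Proof.
  intros [f1 [f2 Hf]] [g1 [g2 Hg]].
  exists (fun x => p * f1 x + q * g1 x), (fun x => p * f2 x + q * g2 x).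
  intros x Hx. destruct (Hf x Hx) as [A1 [A2 A3]]. destruct (Hg x Hx) as [B1 [B2 B3]].
  split; [|split].
  - exact (is_derive_plus _ _ _ _ _ (is_derive_scal _ _ p _ A1) (is_derive_scal _ _ q _ B1)).
  - exact (is_derive_plus _ _ _ _ _ (is_derive_scal _ _ p _ A2) (is_derive_scal _ _ q _ B2)).
  - rewrite <- A3, <- B3. ring.
Qed.

Lemma kummer_op_ext (m : R) (f f' g g' : R -> R) :
  (forall x, f x = f' x) -> (forall x, x < 0 -> g x = g' x) ->
  kummer_op m f g -> kummer_op m f' g'.
Proof.
  intros Ef Eg [f1 [f2 H]]. exists f1, f2. intros x Hx.
  destruct (H x Hx) as [A1 [A2 A3]]. rewrite <- Ef, <- Eg by exact Hx.
  split; [|split; assumption]. apply (is_derive_ext f); assumption.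
Qed.

Lemma kummer_op_psum (m : R) (f g : nat -> R -> R) (M : nat) :
  (forall j, kummer_op m (f j) (g j)) ->
  kummer_op m (fun x => psum (fun j => f j x) M) (fun x => psum (fun j => g j x) M).
Proof.
  intros H. induction M as [|M IH].
  - apply (kummer_op_ext m (fun x => 0 * f 0%nat x + 0 * f 0%nat x) _
             (fun x => 0 * g 0%nat x + 0 * g 0%nat x));
      [intros x; rewrite psum_0; ring|intros x _; rewrite psum_0; ring|].
    apply kummer_op_lincomb; apply H.
  - apply (kummer_op_ext m (fun x => 1 * psum (fun j => f j x) M + 1 * f M x) _
             (fun x => 1 * psum (fun j => g j x) M + 1 * g M x));
      [intros x; rewrite psum_S; ring|intros x _; rewrite psum_S; ring|].
    apply kummer_op_lincomb; [exact IH|apply H].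
Qed.

(** The second solution of the Kummer equation is singular at [0]. *)
Lemma kummer_op_zero (m : R) (h : R -> R) :
  entire h -> h 0 = 0 -> kummer_op m h (fun _ => 0) -> forall x, h x = 0.
Proof.
  intros [a Ha] H0 [h1 [h2 Hop]].
  assert (H : forall y, ex_pseries a y) by (intros y; eexists; apply Ha).
  assert (Eh : forall x, PSeries a x = h x) by (intros x; apply is_pseries_unique, Ha).
  assert (H1 : forall y, ex_pseries (PS_derive a) y)
    by (intros y; eexists; apply is_pseries_derive_PSeries, H).
  assert (E1 : forall x, x < 0 -> PSeries (PS_derive a) x = h1 x).
  { intros x Hx. destruct (Hop x Hx) as [A1 _]. apply is_derive_unique in A1. rewrite <- A1.
    rewrite <- (Derive_ext _ _ x Eh). symmetry.
    apply is_derive_unique, is_pseries_derive_PSeries, H. }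
  assert (E2 : forall x, x < 0 -> PSeries (PS_derive (PS_derive a)) x = h2 x).
  { intros x Hx. destruct (Hop x Hx) as [_ [A2 _]]. apply is_derive_unique in A2. rewrite <- A2.
    rewrite <- (is_derive_unique _ _ _ (proj1 (is_pseries_derive_PSeries _ x H1))).
    apply Derive_ext_loc. apply (filter_imp (fun t => t < 0)); [exact E1|apply (open_lt 0), Hx]. }
  assert (Ek : forall k, kummer_op_coef m a k = 0).
  { intros k. apply (PSeries_zero_left k _ 1); [lra| |].
    - intros y _. eexists. apply is_pseries_kummer_op, H.
    - intros y [_ Hy]. rewrite (is_pseries_unique _ _ _ (is_pseries_kummer_op m a y H)).
      rewrite E1, E2, Eh by exact Hy. apply (Hop y Hy). }
  assert (Ez : forall k, a k = 0).
  { induction k as [|k IH].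
    - rewrite <- (PSeries_0 a), Eh. exact H0.
    (* The factor [(k + 1) (k + 2)] never vanishes, so [a (S k)] is determined by [a k] even where
       [m = k]. *)
    - specialize (Ek k). unfold kummer_op_coef in Ek. rewrite IH, Rmult_0_r, Rplus_0_r in Ek.
      destruct (Rmult_integral _ _ Ek) as [E|E]; [|exact E].
      destruct (Rmult_integral _ _ E) as [E'|E']; apply (INR_eq _ 0) in E'; discriminate. }
  intros x. rewrite <- Eh, (PSeries_ext a (fun _ => 0) x Ez). apply PSeries_const_0.
Qed.

Lemma is_pseries_lag (l : nat) (x : R) :
  is_pseries (fun k => INR (S l) * kummer_coef (- INR l) k) x (lag l x).
Proof.
  exact (is_pseries_scal (K := R_AbsRing) (V := R_NormedModule) (INR (S l)) _ x _
    (Rmult_comm _ _) (is_pseries_kummer (- INR l) x)).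
Qed.

Lemma is_pseries_scal_R (c : R) (a : nat -> R) (x l : R) :
  is_pseries a x l -> is_pseries (fun k => c * a k) x (c * l).
Proof.
  exact (is_pseries_scal (K := R_AbsRing) (V := R_NormedModule) c a x l (Rmult_comm _ _)).
Qed.

Lemma kummer_op_coef_lag (m : R) (l k : nat) :
  kummer_op_coef m (fun k => INR (S l) * kummer_coef (- INR l) k) k
    = (m - INR l) * (INR (S l) * kummer_coef (- INR l) k).
Proof.
  unfold kummer_op_coef, kummer_coef. cbn [pochhammer].
  rewrite !INR_fact_S, !S_INR. pose proof (pos_INR k).
  field. repeat split; try apply INR_fact_neq_0; lra.
Qed.

(** [lag l] solves the equation with parameter [l]; the mismatch of parameters is what cancels the
    denominators of [remainder_term]. *)
Lemma kummer_op_lag (m : R) (l : nat) :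
  kummer_op m (lag l) (fun x => (m - INR l) * lag l x).
Proof.
  apply (kummer_op_pseries m _ _ _ (is_pseries_lag l)). intros x.
  eapply is_pseries_ext; [|apply is_pseries_scal_R, is_pseries_lag].
  intros k. symmetry. apply kummer_op_coef_lag.
Qed.

Lemma dlag_ode (l : nat) (x : R) :
  exists d2, is_derive (dlag l) x d2 /\ x * d2 + (2 - x) * dlag l x + INR l * lag l x = 0.
Proof.
  set (a := fun k => INR (S l) * kummer_coef (- INR l) k).
  assert (H : forall y, ex_pseries a y) by (intros y; eexists; apply is_pseries_lag).
  assert (H1 : forall y, ex_pseries (PS_derive a) y)
    by (intros y; eexists; apply is_pseries_derive_PSeries, H).
  assert (El : forall y, PSeries a y = lag l y) by (intros y; apply is_pseries_unique, is_pseries_lag).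
  assert (Ed : forall y, PSeries (PS_derive a) y = dlag l y).
  { intros y. rewrite <- (is_derive_unique _ _ _ (is_derive_lag l y)).
    rewrite <- (Derive_ext _ _ y El). symmetry.
    apply is_derive_unique, is_pseries_derive_PSeries, H. }
  exists (PSeries (PS_derive (PS_derive a)) x). split.
  - apply (is_derive_ext (PSeries (PS_derive a)) _ _ _ Ed).
    apply is_pseries_derive_PSeries, H1.
  - rewrite <- Ed, <- El.
    rewrite <- (is_pseries_unique _ _ _ (is_pseries_kummer_op (INR l) a x H)).
    rewrite (PSeries_ext _ (fun _ => 0)); [apply PSeries_const_0|].
    intros k. unfold a. rewrite kummer_op_coef_lag. ring.
Qed.

(** Conjugation by [exp] gives [D (exp x * f) = exp x * (D f + 2 x f' + 2 f)], and [D f = (m - l) f]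
    for [f = lag l]. *)
Lemma kummer_op_exp_lag (m : R) (l : nat) :
  kummer_op m (fun x => exp x * lag l x)
    (fun x => exp x * (2 * x * dlag l x + (m + 2 - INR l) * lag l x)).
Proof.
  exists (fun x => exp x * (lag l x + dlag l x)),
    (fun x => exp x * (lag l x + 2 * dlag l x + Derive (dlag l) x)).
  intros x _. destruct (dlag_ode l x) as [d2 [H2 E]].
  pose proof (is_derive_lag l x) as H1.
  rewrite (is_derive_unique _ _ _ H2).
  assert (D1 : ex_derive (lag l) x) by (eexists; exact H1).
  assert (D2 : ex_derive (dlag l) x) by (eexists; exact H2).
  apply is_derive_unique in H1. apply is_derive_unique in H2.
  split; [|split].
  - auto_derive; [exact D1|]. replace (Derive (fun x0 => lag l x0) x) with (Derive (lag l) x) by reflexivity.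
    rewrite H1. ring.
  - auto_derive; [split; [exact D1|split; [exact D2|trivial]]|].
    replace (Derive (fun x0 => lag l x0) x) with (Derive (lag l) x) by reflexivity.
    replace (Derive (fun x0 => dlag l x0) x) with (Derive (dlag l) x) by reflexivity.
    rewrite H1, H2. ring.
  - replace (x * (exp x * (lag l x + 2 * dlag l x + d2))) with
      (exp x * (x * lag l x + 2 * x * dlag l x + (x * d2))) by ring.
    replace (x * d2) with (- ((2 - x) * dlag l x + INR l * lag l x)) by lra.
    ring.
Qed.

(** As [f = lag m] is annihilated, what remains is [2 x ein' f' + (x ein'' + (2 - x) ein') f]; since
    [x ein' = exp x - 1], the bracket equals [1 + ein']. *)
Lemma kummer_op_ein_lag (m : nat) :
  kummer_op (INR m) (fun x => ein x * lag m x)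
    (fun x => 2 * (exp x - 1) * dlag m x + lag m x * (1 + expm1_div x)).
Proof.
  exists (fun x => expm1_div x * lag m x + ein x * dlag m x),
    (fun x => (exp x - expm1_div x) / x * lag m x + 2 * expm1_div x * dlag m x
              + ein x * Derive (dlag m) x).
  intros x Hx. destruct (dlag_ode m x) as [d2 [H2 E]].
  pose proof (is_derive_lag m x) as H1. pose proof (is_derive_ein x) as H3.
  assert (H4 : is_derive expm1_div x ((exp x - expm1_div x) / x)).
  { apply (is_derive_ext_loc (fun t => (exp t - 1) / t)).
    - apply (filter_imp (fun t => t < 0)); [|apply (open_lt 0), Hx].
      intros t Ht. symmetry. apply expm1_div_eq. lra.
    - rewrite expm1_div_eq by lra. auto_derive; [lra|]. field. lra. }
  assert (Ex : x * expm1_div x = exp x - 1) by apply expm1_div_spec.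
  rewrite (is_derive_unique _ _ _ H2).
  split; [|split].
  - exact (is_derive_mult ein (lag m) x _ _ H3 H1 Rmult_comm).
  - pose proof (is_derive_plus _ _ _ _ _ (is_derive_mult expm1_div (lag m) x _ _ H4 H1 Rmult_comm)
      (is_derive_mult ein (dlag m) x _ _ H3 H2 Rmult_comm)) as H.
    replace ((exp x - expm1_div x) / x * lag m x + 2 * expm1_div x * dlag m x + ein x * d2)
      with ((exp x - expm1_div x) / x * lag m x + expm1_div x * dlag m x
            + (expm1_div x * dlag m x + ein x * d2)) by ring.
    exact H.
  - replace (x * ((exp x - expm1_div x) / x * lag m x + 2 * expm1_div x * dlag m x + ein x * d2))
      with ((exp x - expm1_div x) * lag m x + 2 * (x * expm1_div x) * dlag m x + ein x * (x * d2))
      by (field; lra).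
    replace (x * d2) with (- ((2 - x) * dlag m x + INR m * lag m x)) by lra.
    replace ((2 - x) * (expm1_div x * lag m x + ein x * dlag m x))
      with (2 * expm1_div x * lag m x - (x * expm1_div x) * lag m x + (2 - x) * (ein x * dlag m x))
      by ring.
    rewrite Ex. ring.
Qed.

Lemma kummer_op_expm1_div (m : R) :
  kummer_op m expm1_div (fun x => (m + 1) * expm1_div x).
Proof.
  apply (kummer_op_pseries m _ _ _ is_pseries_expm1_div). intros x.
  eapply is_pseries_ext; [|apply is_pseries_scal_R, is_pseries_expm1_div].
  intros k. unfold kummer_op_coef, expm1_div_coef. rewrite !INR_fact_S, !S_INR.
  pose proof (pos_INR k). eqR. field. repeat split; try apply INR_fact_neq_0; lra.
Qed.

(** Differentiating the Kummer equation in its parameter. *)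
Lemma kummer_op_dkummer (m : nat) :
  kummer_op (INR m) (fun x => INR (S m) * PSeries (dkummer_coef (- INR m)) x) (lag m).
Proof.
  apply (kummer_op_pseries _ _ _ _ (fun x => is_pseries_scal_R _ _ _ _ (is_pseries_dkummer _ x))).
  intros x. eapply is_pseries_ext; [|apply is_pseries_lag].
  intros k. unfold kummer_op_coef, dkummer_coef, kummer_coef. cbn [dpochhammer].
  rewrite !INR_fact_S, !S_INR. pose proof (pos_INR k).
  eqR. field. repeat split; try apply INR_fact_neq_0; lra.
Qed.

(** * Assembly of the closed form *)

Lemma psum_ext (f g : nat -> R) (m : nat) :
  (forall j, (j < m)%nat -> f j = g j) -> psum f m = psum g m.
Proof.
  induction m as [|m IH]; intros H; [rewrite !psum_0; reflexivity|].
  rewrite !psum_S, IH, H; auto with arith.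
Qed.

Lemma psum_lincomb (p q : R) (f g : nat -> R) (m : nat) :
  psum (fun j => p * f j + q * g j) m = p * psum f m + q * psum g m.
Proof.
  induction m as [|m IH]; [rewrite !psum_0; ring|]. rewrite !psum_S, IH. ring.
Qed.

(** Split into [lag j] and [exp * lag j], the two functions whose images under the Kummer operator
    are known. *)
Definition remainder_term (m j : nat) (x : R) : R :=
  (INR (S m) + INR (S j)) / (INR (S m) - INR (S j)) / INR (S j) * lag j x
  + - (cut_coef j m / INR (S j)) * (exp x * lag j x).

Lemma entire_exp : entire exp.
Proof. eexists. intros x. apply is_exp_Reals. Qed.

Lemma entire_lag (m : nat) : entire (lag m).
Proof. eexists. intros x. apply is_pseries_lag. Qed.

(** Both halves leave the same sum: the polynomial one through the cancelled denominators, the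
    exponential one by [psum_cut_coef_lag]. Hence the factor [1 - exp x]. *)
Lemma kummer_op_remainder (m : nat) :
  kummer_op (INR m) (fun x => psum (fun j => remainder_term m j x) m)
    (fun x => (1 - exp x) *
       psum (fun j => (INR (S m) + INR (S j)) / INR (S j) * lag j x) m).
Proof.
  eapply kummer_op_ext; [reflexivity| |apply kummer_op_psum; intros j;
    apply kummer_op_lincomb; [apply kummer_op_lag|apply kummer_op_exp_lag]].
  intros x _. cbv beta.
  transitivity (1 * psum (fun j => (INR (S m) + INR (S j)) / INR (S j) * lag j x) m
    + (- exp x) * psum (fun j => cut_coef j m / INR (S j)
          * (2 * x * dlag j x + (INR m + 2 - INR j) * lag j x)) m).
  - rewrite <- psum_lincomb. apply psum_ext. intros j Hj.
    apply lt_INR in Hj. rewrite !S_INR. pose proof (pos_INR j). field. lra.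
  - rewrite !psum_cut_coef_lag. ring.
Qed.

Lemma dkummer_closed_form (m : nat) (x : R) :
  INR (S m) * PSeries (dkummer_coef (- INR m)) x
    = - expm1_div x + (harmonic (S m) + ein x) * lag m x
      - psum (fun j => remainder_term m j x) m.
Proof.
  (* The difference of the two sides; the coefficients [1] and [-1] give it the shape of nested
     linear combinations to which [entire_lincomb] and [kummer_op_lincomb] apply. *)
  set (h := fun x => 1 * (1 * (INR (S m) * PSeries (dkummer_coef (- INR m)) x)
                          + 1 * psum (fun j => remainder_term m j x) m)
    + 1 * (1 * expm1_div x + (-1) * (harmonic (S m) * lag m x + 1 * (ein x * lag m x)))).
  assert (H : h x = 0); [|unfold h in H; lra].
  apply (kummer_op_zero (INR m)).
  - assert (Hl := entire_lag m).
    apply entire_lincomb; apply entire_lincomb; [| | |apply entire_lincomb].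
    + eexists. intros y. apply is_pseries_scal_R, is_pseries_dkummer.
    + apply entire_psum. intros j.
      apply entire_lincomb; [|apply entire_mult; [exact entire_exp|]]; apply entire_lag.
    + eexists. apply is_pseries_expm1_div.
    + exact Hl.
    + apply entire_mult; [|exact Hl].
      exists ein_coef. intros y. apply PSeries_correct, ex_pseries_ein.
  (* At [0] everything reduces to [2 - 2 n (H_n - H_m)] with [n = m + 1], which is zero. *)
  - unfold h. rewrite PSeries_0, ein_0, lag_0.
    assert (E1 : expm1_div 0 = 1).
    { unfold expm1_div. rewrite PSeries_0. unfold expm1_div_coef. simpl. field. }
    assert (E2 : dkummer_coef (- INR m) 0 = 0) by (unfold dkummer_coef; simpl; field).
    assert (E3 : psum (fun j => remainder_term m j 0) m
      = 2 * INR (S m) * harmonic m - INR m - (INR (S m) * harmonic (S m) - INR (S m))).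
    { pose proof (psum_inv_reverse m m (le_n m)) as A.
      rewrite Nat.sub_diag, harmonic_0 in A.
      rewrite <- psum_cut_coef.
      replace (2 * INR (S m) * harmonic m) with (2 * INR (S m) * (harmonic m - 0)) by ring.
      rewrite <- A, <- psum_ratio, <- psum_lag_0 by apply le_n.
      apply psum_ext. intros j Hj. unfold remainder_term. rewrite exp_0.
      apply lt_INR in Hj. rewrite !S_INR. pose proof (pos_INR j). field. lra. }
    rewrite E1, E2, E3, harmonic_S, !S_INR. pose proof (pos_INR m). field. lra.
  - eapply kummer_op_ext; [reflexivity| |
      apply kummer_op_lincomb; apply kummer_op_lincomb;
        [apply kummer_op_dkummer|apply kummer_op_remainder|apply kummer_op_expm1_div
        |apply kummer_op_lincomb; [apply kummer_op_lag|apply kummer_op_ein_lag]]].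
    intros y Hy. cbv beta.
    (* After multiplication by [y] the sum is known from [psum_lag_eq] and [y * expm1_div y] is
       [exp y - 1]; all terms cancel. *)
    apply (Rmult_eq_reg_l y); [|lra].
    set (P := psum _ m). pose proof (psum_lag_eq m y) as E. fold P in E.
    transitivity ((1 - exp y) * (y * P) + y * lag m y + INR (S m) * (y * expm1_div y)
      - (2 * (exp y - 1) * (y * dlag m y) + lag m y * (y + y * expm1_div y)));
      [rewrite S_INR; ring|].
    rewrite E, expm1_div_spec. ring.
Qed.

Theorem corollary7 :
  forall (n : nat) (x : R) (upper : bool),
    (1 <= n)%nat -> x <> 0 ->
    ex_derive (fun a => hyp1F1 a 2 x) (1 - INR n) /\
    G1 (1 - INR n) 2 x =
      1 / INR n *
      ((1 - exp x) / x
       - (ln (Rabs x) + euler_gamma - harmonic n - Ei x) * laguerre (n - 1) 1 x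
       - sum_n_m (fun l : nat =>
           ((INR n + INR l) / (INR n - INR l)
            - exp x * Re (hyp2F1_cut upper 1 (INR l) (INR l + INR n) 2))
           * (laguerre (l - 1) 1 x / INR l)) 1 (n - 1)).
Proof.
  intros [|m] x upper Hn Hx; [lia|]. clear Hn.
  replace (1 - INR (S m)) with (- INR m) by (rewrite S_INR; ring).
  pose proof (is_derive_hyp1F1 (- INR m) x) as HD.
  split; [eexists; exact HD|].
  replace (G1 (- INR m) 2 x) with (PSeries (dkummer_coef (- INR m)) x)
    by (symmetry; exact (is_derive_unique _ _ _ HD)).
  rewrite Nat.sub_succ, Nat.sub_0_r.
  assert (Esum : sum_n_m (fun l : nat =>
           ((INR (S m) + INR l) / (INR (S m) - INR l)
            - exp x * Re (hyp2F1_cut upper 1 (INR l) (INR l + INR (S m)) 2))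
           * (laguerre (l - 1) 1 x / INR l)) 1 m = psum (fun j => remainder_term m j x) m).
  { apply sum_n_m_ext_loc. intros [|j] Hj; [lia|].
    rewrite Nat.sub_succ, Nat.sub_0_r, Re_hyp2F1_cut, laguerre_lag.
    unfold remainder_term, cut_coef.
    eqR. unfold Rdiv. ring. }
  rewrite Esum, laguerre_lag, Ei_series by exact Hx.
  pose proof (dkummer_closed_form m x) as E.
  assert (Hm : INR (S m) <> 0) by (apply not_0_INR; lia).
  apply (Rmult_eq_reg_l (INR (S m))); [|exact Hm].
  rewrite E, expm1_div_eq by exact Hx. field. auto.
Qed.
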